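(* Let $X\subset\mathbb{P}^n$ be a reduced non-degenerate projective variety satisfying property $\mathbf{N}_{2,p}$ scheme-theoretically with $p\ge 2$. Let $q\in\mathbb{P}^n\setminus X$, let $\pi_q:X\to Y_1=\pi_q(X)\subset\mathbb{P}^{n-1}$ be the projection from $q$, and suppose that the secant locus $$\Sigma_q(X)=\{x\in X\mid \pi_q^{-1}(\pi_q(x))\text{ has length}\ge 2\}$$ is nonempty. Let $Z_1=\{y\in Y_1\mid \pi_q^{-1}(y)\text{ has length}\ge 2\}$. Then: (a) $\Sigma_q(X)$ is a quadric hypersurface in a linear subspace $L\subset\mathbb{P}^n$, and $q\in L$. (b) $\pi_q(\Sigma_q(X))=Z_1$ is a linear space, which is the support of the cokernel of $\mathcal{O}_{Y_1}\hookrightarrow{\pi_q}_*(\mathcal{O}_X)$. (c) If $q\in\mathrm{Sec}(X)\setminus(\mathrm{Tan}(X)\cup X)$, then $\Sigma_q(X)$ consists of two distinct points.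
   Context: The base field $k$ is algebraically closed of characteristic zero, and $R=k[x_0,\ldots,x_n]$ is the coordinate ring of $\mathbb{P}^n$. $X$ satisfies $\mathbf{N}_{2,p}$ scheme-theoretically if there is a homogeneous ideal $I\subset R$ (not necessarily saturated) generating the ideal sheaf $\mathcal{I}_{X/\mathbb{P}^n}$ such that $I$ is generated by quadrics and there are only linear syzygies up to the $p$-th step, i.e. $\mathrm{Tor}^R_i(R/I,k)_{i+j}=0$ for $1\le i\le p$ and $j\ne 1$. $\mathrm{Sec}(X)$ and $\mathrm{Tan}(X)$ are the secant variety and the tangent variety (union of embedded tangent spaces) of $X$ in $\mathbb{P}^n$. *)

(* Defs.v *)
From HB Require Import structures.
From mathcomp Require Import all_boot all_order all_algebra.
From mathcomp Require Import mpoly.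
Set Implicit Arguments.
Unset Strict Implicit.
Unset Printing Implicit Defensive.
Import GRing.Theory.
Local Open Scope ring_scope.

(* A point of P^(m-1) is given by homogeneous coordinates, a nonzero row vector
   in 'rV[k]_m; a set of points is a predicate on row vectors that is false at
   0 and invariant under nonzero scalars (both are consequences of
   [proj_closed] or [proj_open]).  A linear subspace of P^(m-1) is the row
   space of a matrix. *)

Section ProjectiveSets.
Variables (k : closedFieldType) (m : nat).
Implicit Types (x y z : 'rV[k]_m) (X Z U : 'rV[k]_m -> Prop).

Definition same_point x y : bool := (x == y)%MS.

Definition homogeneous_family (F : {mpoly k[m]} -> Prop) : Prop :=
  forall f, F f -> exists d : nat, f \is d.-homog.

Definition proj_closed Z : Prop :=
  exists2 F : {mpoly k[m]} -> Prop, homogeneous_family F &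
    forall x, Z x <-> x != 0 /\ (forall f, F f -> f.@[x 0] = 0).

Definition proj_open U : Prop :=
  exists2 F : {mpoly k[m]} -> Prop, homogeneous_family F &
    forall x, U x <-> x != 0 /\ (exists2 f, F f & f.@[x 0] != 0).

Definition proj_closure Z : 'rV[k]_m -> Prop := fun x =>
  x != 0 /\ forall W, proj_closed W -> (forall z, Z z -> W z) -> W x.

Definition nondegenerate_variety X : Prop :=
  forall a : 'cV[k]_m, (forall x, X x -> x *m a = 0) -> a = 0.

(* As X is a cone and k is infinite, this ideal is homogeneous: it is the
   saturated homogeneous ideal of the reduced scheme X. *)
Definition vanishing_ideal X : {mpoly k[m]} -> Prop := fun f =>
  forall x, X x -> f.@[x 0] = 0.

Definition Sec X : 'rV[k]_m -> Prop :=
  proj_closure (fun z => z != 0 /\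
    exists x y, [/\ X x, X y, ~~ same_point x y & (z <= x + y)%MS]).

Definition embedded_tangent_space X x : 'rV[k]_m -> Prop := fun z =>
  z != 0 /\ forall f, vanishing_ideal X f ->
    \sum_(i < m) (f^`M(i)).@[x 0] * z 0 i = 0.

Definition Tan X : 'rV[k]_m -> Prop := fun z =>
  exists2 x, X x & embedded_tangent_space X x z.

(* Regular functions on a locally closed subset with its reduced structure. *)
Definition regular_on Z (phi : 'rV[k]_m -> k) : Prop :=
  forall x, Z x -> exists (d : nat) (F G : {mpoly k[m]}),
    [/\ F \is d.-homog, G \is d.-homog, G.@[x 0] != 0
      & forall z, Z z -> G.@[z 0] != 0 -> phi z = F.@[z 0] / G.@[z 0]].

End ProjectiveSets.

Section PropertyN2p.
Variables (k : closedFieldType) (m : nat).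
Local Notation R := {mpoly k[m]}.

Definition is_ideal (I : R -> Prop) : Prop :=
  [/\ I 0, forall f g, I f -> I g -> I (f + g) & forall a f, I f -> I (a * f)].

Definition homogeneous_ideal (I : R -> Prop) : Prop :=
  is_ideal I /\ forall (f : R) (d : nat), I f -> I (pihomog mdeg d f).

Definition generated_by_quadrics (I : R -> Prop) : Prop :=
  forall f, I f -> exists (r : nat) (a g : 'I_r -> R),
    (forall i, g i \is 2.-homog /\ I (g i)) /\ f = \sum_i a i * g i.

(* Over the chart x_i != 0 the sections of the sheaf of I are the f / x_i^d
   with f homogeneous of degree d and x_i^N f in I for some N, and those of the
   ideal sheaf of X are the f / x_i^d vanishing at all points of X there. *)
Definition generates_ideal_sheaf (I : R -> Prop) (X : 'rV[k]_m -> Prop) : Prop :=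
  forall (i : 'I_m) (d : nat) (f : R), f \is d.-homog ->
    (exists N : nat, I ('X_i ^+ N * f)) <->
    (forall x : 'rV[k]_m, X x -> x 0 i != 0 -> f.@[x 0] = 0).

(* A graded free resolution of R/I.  F_i is the sum of the R(- res_shift i a),
   a < res_rank i; maps act on row vectors from the right, the differential
   F_(i+1) -> F_i is [diff i], and [aug] : F_0 -> R induces F_0 -> R/I. *)
Record graded_free_resolution (I : R -> Prop) := GradedFreeResolution {
  res_rank : nat -> nat;
  res_shift : forall i, 'I_(res_rank i) -> nat;
  aug : 'cV[R]_(res_rank 0);
  diff : forall i, 'M[R]_(res_rank i.+1, res_rank i);
  aug_homog : forall a (u : 'X_{1..m}),
    u \in msupp (aug a 0) -> mdeg u = res_shift a;
  diff_homog : forall i a b (u : 'X_{1..m}),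
    u \in msupp (diff i a b) -> (mdeg u + res_shift b)%N = res_shift a;
  aug_surj : forall f : R, exists v : 'rV[R]_(res_rank 0), I (f - (v *m aug) 0 0);
  exact_0 : forall v : 'rV[R]_(res_rank 0),
    I ((v *m aug) 0 0) <-> exists w, v = w *m diff 0;
  exact_S : forall i (v : 'rV[R]_(res_rank i.+1)),
    v *m diff i = 0 <-> exists w, v = w *m diff i.+1 }.

Section Tor.
Variables (I : R -> Prop) (F : graded_free_resolution I).

(* The differential of F (x) k, where k = R/(x_0, ..., x_(m-1)). *)
Definition diff_k (i : nat) : 'M[k]_(res_rank F i.+1, res_rank F i) :=
  map_mx (mcoeff 0%MM) (diff F i).

Definition in_degree (i d : nat) (v : 'rV[k]_(res_rank F i)) : Prop :=
  forall a, v 0 a != 0 -> res_shift a = d.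

Definition is_cycle (i : nat) : 'rV[k]_(res_rank F i) -> Prop :=
  match i with
  | 0 => fun=> True
  | i'.+1 => fun v => v *m diff_k i' = 0
  end.

(* Tor_i^R(R/I, k)_d = 0, as the degree d part of H_i(F (x) k). *)
Definition Tor_vanishes (i d : nat) : Prop :=
  forall v : 'rV[k]_(res_rank F i), in_degree d v -> is_cycle v ->
    exists2 w : 'rV[k]_(res_rank F i.+1), in_degree d w & v = w *m diff_k i.

End Tor.

(* Tor does not depend on the resolution.  Every degree d other than i + 1 is
   excluded; Tor_i(R/I, k) has no part in negative degrees. *)
Definition N2p_scheme_theoretically (p : nat) (X : 'rV[k]_m -> Prop) : Prop :=
  exists I : R -> Prop,
    [/\ homogeneous_ideal I, generates_ideal_sheaf I X,
        generated_by_quadrics I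
      & exists F : graded_free_resolution I,
          forall i d : nat, (1 <= i <= p)%N -> d != i.+1 -> Tor_vanishes F i d].

End PropertyN2p.

(* The projection from q is x |-> x *m A, where A has kernel the line of q. *)
Section Projection.
Variables (k : closedFieldType) (n : nat).
Variables (q : 'rV[k]_n.+1) (A : 'M[k]_(n.+1, n)) (X : 'rV[k]_n.+1 -> Prop).

Definition proj_image (Z : 'rV[k]_n.+1 -> Prop) : 'rV[k]_n -> Prop :=
  fun y => exists2 x, Z x & y = x *m A.

Definition restrict_to_line (u v : 'rV[k]_n.+1) (f : {mpoly k[n.+1]}) : {poly k} :=
  mmap (@polyC k) (fun i => (u 0 i)%:P + v 0 i *: 'X) f.

(* The fibre over y of P^n \ {q} -> P^(n-1) is the affine line of the points
   u + t q, where u := y *m pinvmx A satisfies u *m A = y.  For q outside X,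
   the fibre of X over y is the subscheme of that line Spec k[t] cut out by
   this ideal (another choice of u amounts to a translation of t). *)
Definition fibre_ideal (y : 'rV[k]_n) : {poly k} -> Prop := fun g =>
  exists2 f, vanishing_ideal X f & g = restrict_to_line (y *m pinvmx A) q f.

(* dim_k k[t]/J >= r *)
Definition colength_ge (r : nat) (J : {poly k} -> Prop) : Prop :=
  exists v : 'I_r -> {poly k},
    forall c : 'I_r -> k, J (\sum_i c i *: v i) -> forall i, c i = 0.

Definition fibre_length_ge (r : nat) (y : 'rV[k]_n) : Prop :=
  colength_ge r (fibre_ideal y).

Definition secant_locus : 'rV[k]_n.+1 -> Prop := fun x =>
  X x /\ fibre_length_ge 2 (x *m A).

Definition Z_1 : 'rV[k]_n -> Prop := fun y =>
  proj_image X y /\ fibre_length_ge 2 y.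

(* Surjectivity of O_{Y_1,y} -> (pi_q_* O_X)_y, with Y_1 = pi_q(X) reduced. *)
Definition stalk_surjective (y : 'rV[k]_n) : Prop :=
  forall (U : 'rV[k]_n -> Prop) (phi : 'rV[k]_n.+1 -> k),
    proj_open U -> U y -> regular_on (fun x => X x /\ U (x *m A)) phi ->
    exists (V : 'rV[k]_n -> Prop) (psi : 'rV[k]_n -> k),
      [/\ proj_open V, V y, forall z, V z -> U z,
          regular_on (fun z => proj_image X z /\ V z) psi
        & forall x, X x -> V (x *m A) -> phi x = psi (x *m A)].

Definition coker_support : 'rV[k]_n -> Prop := fun y =>
  proj_image X y /\ ~ stalk_surjective y.

End Projection.

Section Linear.
Variables (k : closedFieldType) (m : nat).

Definition is_linear_space (Z : 'rV[k]_m -> Prop) : Prop :=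
  exists M : 'M[k]_m, forall y, Z y <-> y != 0 /\ (y <= M)%MS.

Definition quadric_hypersurface_in (L : 'M[k]_m) (Z : 'rV[k]_m -> Prop) : Prop :=
  exists Q : {mpoly k[m]},
    [/\ Q \is 2.-homog, exists2 x : 'rV[k]_m, (x <= L)%MS & Q.@[x 0] != 0
      & forall x, Z x <-> [/\ x != 0, (x <= L)%MS & Q.@[x 0] = 0]].

End Linear.

(* Main.v *)
Require Import Defs.
From HB Require Import structures.
From mathcomp Require Import all_boot all_order all_algebra.
From mathcomp Require Import mpoly.
From mathcomp Require Import ring.
From Stdlib Require Import Classical.
Set Implicit Arguments.
Unset Strict Implicit.
Unset Printing Implicit Defensive.
Import GRing.Theory.
Local Open Scope ring_scope.

(** Fix linear forms Y_1, ..., Y_n (the coordinates of the target of the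
    projection from q) and lam, with lam(q) = 1, that together form a basis of
    all linear forms, and write S = k[Y_1, ..., Y_n].  Let I be the ideal
    provided by N_{2,p} and M = R/I.  Since q is not on X, some quadric f1 of I
    has f1(q) = 1, so f1 is monic of degree 2 in lam, and M is generated over S
    by 1 and lam.

    The homological input is the exact sequence
    0 -> (R (x)_S M)(-1) -> R (x)_S M -> M -> 0, whose long exact sequence
    contains
    Tor_2^R(M,k)_(d+1) -> Tor_1^S(M,k)_d -> Tor_1^S(M,k)_(d+1)
    where the second arrow is multiplication by lam.  As Tor_2^R(M,k) lives in
    degree 3, this arrow is injective for d >= 3; but lam^2 kills Tor_1^S(M,k),
    because lam^2 is congruent to f1 modulo the Y_j.  Hence the relations of M
    over S are generated in degree 2.  [span_of_lam_mul_span] is the injectivity,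
    by a chase in the given resolution, and [center_kernel_span] the
    consequence in the form used below: an element of I of degree at least 3
    that vanishes on the line of q lies in (Y_1, ..., Y_n) I.

    So the quadrics of I decide everything about the lines u + t q.  Let
    [polar_space] be the linear space of the u for which no quadric of I
    vanishing at q has a term linear in t on that line.  For u in it, induction
    on the degree shows that all of I restricts to multiples of the polynomial
    f1(u + t q), which is monic of degree 2 ([dvdp_restrict]); for any other u
    some quadric of I restricts to a polynomial of degree 1.  Passing from I to
    the vanishing ideal of X costs powers of the coordinates only, and on a line
    that avoids the origin these have no common zero ([saturated_dvdp]).  Hence
    a fibre has length at least 2 exactly when it lies over the polar space
    ([fibre_ge2]).  The secant locus is the quadric f1 = 0 in the polar space, and
    Z_1 is the projection of the polar space.

    At a point y of Z_1 the function lam/Y_j is not pulled back from the image: a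
    local equation lam G = Y_j F on X would put a polynomial of degree 1 in the
    fibre ideal.  Off Z_1 a quadric kappa with kappa(u + t q) = kappa(u) + l(u) t
    and l(u) <> 0 expresses lam on X as a rational function of the Y_j, which
    gives a local inverse of the projection.

    For the last claim, a zero off q of the discriminant of f1(u + t q) on the
    polar space would be a double point of the quadric on a line through q, and
    that line would be tangent to X ([tangent_line]).  A quadratic form on a space
    of dimension at least 2 has a nontrivial zero, so outside Tan(X) the polar
    space is a line through q, and the quadric cuts it in two points. *)

(** * Polynomials, homogeneous parts and spans over an ideal *)

Section MPolyGeneral.
Variables (k : closedFieldType) (m : nat).
Local Notation R := {mpoly k[m]}.
Implicit Types (f g a : R) (I : R -> Prop).

Lemma mpoly_ring_ind (P : R -> Prop) :
  (forall c, P c%:MP) -> (forall i, P 'X_i) ->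
  (forall f g, P f -> P g -> P (f + g)) ->
  (forall f g, P f -> P g -> P (f * g)) -> forall f, P f.
Proof.
move=> PC PX PD PM; apply: mpolyind => [|c u p _ _ Pp]; first by rewrite -mpolyC0.
apply: PD => //; rewrite -mul_mpolyC; apply: (PM) => //.
rewrite mpolyXE_id; apply: (big_ind P) => [||i _]; [by rewrite -mpolyC1 | exact: PM | ].
elim: (u i) => [|e IH]; first by rewrite expr0 -mpolyC1.
by rewrite exprS; apply: PM.
Qed.

(** For an ideal I this is the product of (y_1, ..., y_r) and I, so for I = R the
    ideal generated by the y_j; I may also be the set of its forms of one degree. *)
Definition in_span r (y : 'I_r -> R) I f :=
  exists2 g : 'I_r -> R, (forall j, I (g j)) & f = \sum_j y j * g j.

Lemma in_spanD r (y : 'I_r -> R) I f g : is_ideal I ->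
  in_span y I f -> in_span y I g -> in_span y I (f + g).
Proof.
move=> [_ ID _] [a Ia ->] [b Ib ->]; exists (fun j => a j + b j) => [j|]; first exact: ID.
by rewrite -big_split /=; apply: eq_bigr => j _; rewrite mulrDr.
Qed.

Lemma in_spanMl r (y : 'I_r -> R) I f a : is_ideal I ->
  in_span y I f -> in_span y I (a * f).
Proof.
move=> [_ _ IM] [g Ig ->]; exists (fun j => a * g j) => [j|]; first exact: IM.
by rewrite mulr_sumr; apply: eq_bigr => j _; rewrite mulrCA.
Qed.

Lemma in_spanMr r (y : 'I_r -> R) I f a : is_ideal I -> I f ->
  in_span y (fun=> True) a -> in_span y I (a * f).
Proof.
move=> [_ _ IM] If [g _ ->]; exists (fun j => g j * f) => [j|]; first exact: IM.
by rewrite mulr_suml; apply: eq_bigr => j _; rewrite mulrA.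
Qed.

Lemma in_span_gen r (y : 'I_r -> R) I i f : is_ideal I -> I f -> in_span y I (y i * f).
Proof.
move=> [I0 _ _] If; exists (fun j => if j == i then f else 0) => [j|]; first by case: ifP.
rewrite (bigD1 i) //= eqxx big1 ?addr0 // => j /negPf ->; exact: mulr0.
Qed.

(** Two k-algebra morphisms that agree on the variables modulo an ideal agree
    modulo it everywhere; here one of them is the identity. *)
Lemma sub_retract_span r (y : 'I_r -> R) (h : {rmorphism R -> R}) :
  (forall c, h c%:MP = c%:MP) ->
  (forall i, in_span y (fun=> True) ('X_i - h 'X_i)) ->
  forall f, in_span y (fun=> True) (f - h f).
Proof.
move=> hC hX; apply: mpoly_ring_ind => [c|i|f g IHf IHg|f g IHf IHg]; last 2 first.
- by rewrite rmorphD opprD addrACA; apply: in_spanD.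
- rewrite rmorphM.
  have -> : f * g - h f * h g = h f * (g - h g) + g * (f - h f) by ring.
  by apply: in_spanD => //; apply: in_spanMl.
- rewrite hC subrr; exists (fun=> 0) => //.
  by rewrite big1 // => j _; rewrite mulr0.
- exact: hX.
Qed.

Lemma irrelevant_span f : f@_0 = 0 -> in_span (fun i : 'I_m => 'X_i : R) (fun=> True) f.
Proof.
move=> f0.
have := @sub_retract_span _ (fun i : 'I_m => 'X_i) (@mpolyC m k \o mcoeff 0%MM).
have -> : (f = f - (@mpolyC m k \o mcoeff 0%MM) f) by rewrite /= f0 mpolyC0 subr0.
apply=> [c|i] /=; first by rewrite mpolyCK.
rewrite mcoeffX -[U_(i)%MM == _]mdeg_eq0 mdeg1 mpolyC0 subr0.
by rewrite -['X_i]mulr1; apply: (@in_span_gen _ (fun i : 'I_m => 'X_i : R) (fun=> True)).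
Qed.

(** The closed form with a conditional, rather than two lemmas, is what lets a
    degree component commute with the matrices of a resolution, some of whose
    basis elements have degrees above the component considered. *)
Lemma pihomogM d e a g : g \is e.-homog ->
  pihomog mdeg d (a * g) = if (e <= d)%N then pihomog mdeg (d - e) a * g else 0.
Proof.
move=> gh; elim/mpolyind: a => [|c u a _ _ IH].
  by rewrite mul0r !linear0 mul0r; case: ifP.
rewrite mulrDl !linearD /= IH -scalerAl !linearZ /= pihomogX.
have hu : 'X_[u] * g \is (mdeg u + e).-homog by apply: dhomogM; rewrite ?dhomogX.
case: leqP => [le_ed|lt_de]; last first.
  by rewrite (pihomog_ne0 _ hu) ?scaler0 ?addr0 // gtn_eqF // ltn_addl.
rewrite mulrDl -scalerAl; congr (_ *: _ + _).
have [/eqP|ne] := eqVneq (mdeg u) (d - e)%N.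
  rewrite -(eqn_add2r e) subnK // => /eqP <-; exact: pihomog_dE.
by rewrite mul0r (pihomog_ne0 _ hu) // -(subnK le_ed) eqn_add2r.
Qed.

Lemma mmap_scale (S : comNzRingType) (phi : {rmorphism k -> S}) (h : 'I_m -> S) c d f :
  f \is d.-homog -> mmap phi (fun i => c * h i) f = c ^+ d * mmap phi h f.
Proof.
move=> /dhomogP fh; rewrite /mmap mulr_sumr; apply: eq_big_seq => u /fh /= <-.
rewrite mulrCA; congr (_ * _); rewrite /mmap1 mdegE -prodrXr -big_split /=.
by apply: eq_bigr => i _; rewrite exprMn.
Qed.

Lemma meval_scale c d f (x : 'rV[k]_m) : f \is d.-homog ->
  f.@[(c *: x) 0] = c ^+ d * f.@[x 0].
Proof.
move=> fh; rewrite -(mmap_scale idfun _ _ fh); apply: meval_eq => i.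
by rewrite mxE.
Qed.
End MPolyGeneral.

Lemma comp_mpoly_homog (k : closedFieldType) m r d e (f : {mpoly k[m]})
    (s : m.-tuple {mpoly k[r]}) :
  f \is d.-homog -> (forall i, tnth s i \is e.-homog) -> f \mPo s \is (d * e).-homog.
Proof.
move=> /dhomogP fh sh; rewrite comp_mpolyE big_seq; apply: rpred_sum => u /fh /= <-.
apply: rpredZ; rewrite mdegE big_distrl /=.
elim/big_rec2: _ => [|i d' p _ ph]; first exact: dhomog1.
by apply: dhomogM => //; rewrite mulnC; apply: dhomogMn.
Qed.

Lemma pihomog_mdeg0 (k : closedFieldType) m (f : {mpoly k[m]}) : pihomog mdeg 0 f = (f@_0)%:MP.
Proof.
elim/mpolyind: f => [|c u f _ _ IH]; first by rewrite linear0 mcoeff0 mpolyC0.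
rewrite !linearD !linearZ /= IH pihomogX mcoeffX mdeg_eq0 rmorphD /= rmorphM /=.
rewrite -mul_mpolyC; congr (_ * _ + _).
by case: eqVneq => [->|_]; rewrite ?mpolyX0 ?mpolyC1 ?mpolyC0.
Qed.

(** * Homogeneous components in graded free modules *)

Section GradedComponents.
Variables (k : closedFieldType) (m : nat).
Local Notation R := {mpoly k[m]}.

(** The basis element of index a has degree sh a; components below that degree
    are zero, so truncated subtraction does no harm. *)
Definition homog_component r (sh : 'I_r -> nat) D (v : 'rV[R]_r) : 'rV[R]_r :=
  \row_a (if (sh a <= D)%N then pihomog mdeg (D - sh a) (v 0 a) else 0).

Lemma homog_component_mulmx r s (shr : 'I_r -> nat) (shs : 'I_s -> nat) D
    (v : 'rV[R]_r) (M : 'M[R]_(r, s)) :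
  (forall a b (u : 'X_{1..m}), u \in msupp (M a b) -> (mdeg u + shs b)%N = shr a) ->
  homog_component shs D (v *m M) = homog_component shr D v *m M.
Proof.
move=> hM; apply/rowP => b; rewrite !mxE.
have Mh a : M a b \is (shr a - shs b).-homog.
  by apply/dhomogP => u /hM <-; rewrite addnK.
have M0 a : (shr a < shs b)%N -> M a b = 0.
  move=> lt; apply/eqP; rewrite -msupp_eq0; apply/contraTT: lt.
  by case: (msupp _) (hM a b) => //= u s' /(_ u (mem_head _ _)) <- _; rewrite -leqNgt leq_addl.
case: ifP => [leb|/negbT]; last rewrite -ltnNge => ltb.
  rewrite linear_sum; apply: eq_bigr => a _; rewrite !mxE /= (pihomogM _ _ (Mh a)).
  have [/M0->|lt] := ltnP (shr a) (shs b); first by rewrite !mulr0 if_same.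
  rewrite leq_subLR subnKC // -subnDA subnKC //; case: ifP => //; by rewrite mul0r.
rewrite big1 // => a _; rewrite !mxE; case: ifP => [lea|]; last by rewrite mul0r.
by rewrite M0 ?mulr0 // (leq_ltn_trans lea).
Qed.

Lemma homog_componentB r (sh : 'I_r -> nat) D v w :
  homog_component sh D (v - w) = homog_component sh D v - homog_component sh D w.
Proof. by apply/rowP => a; rewrite !mxE; case: ifP; rewrite ?subrr // linearB. Qed.

Lemma homog_component_sum r (sh : 'I_r -> nat) D N (v : 'I_N -> 'rV[R]_r) :
  homog_component sh D (\sum_j v j) = \sum_j homog_component sh D (v j).
Proof.
apply/rowP => a; rewrite !mxE !summxE; under [RHS]eq_bigr do rewrite mxE.
by case: ifP => _; [rewrite linear_sum | rewrite big1].
Qed.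

Lemma homog_componentZ r (sh : 'I_r -> nat) D (l : R) v : l \is 1.-homog ->
  homog_component sh D.+1 (l *: v) = l *: homog_component sh D v.
Proof.
move=> lh; apply/rowP => a; rewrite !mxE mulrC (pihomogM _ _ lh) subn_gt0 ltnS.
case: (ltngtP (sh a) D.+1) => [|lt|->]; rewrite ?ltnn ?mulr0 //.
  by rewrite ltnS => le; rewrite le subSn // subn1 mulrC.
by rewrite leqNgt (ltn_trans _ lt) ?mulr0.
Qed.

End GradedComponents.

(** * Linear forms and restriction to lines *)

HB.instance Definition _ (k : closedFieldType) n (u v : 'rV[k]_n.+1) :=
  GRing.RMorphism.copy (restrict_to_line u v)
   (mmap (@polyC k) (fun i => (u 0 i)%:P + v 0 i *: 'X)).

Section LinearForms.
Variables (k : closedFieldType) (m : nat).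

Definition linform (a : 'cV[k]_m) : {mpoly k[m]} := \sum_i a i 0 *: 'X_i.

Lemma linform_homog a : linform a \is 1.-homog.
Proof. by apply: rpred_sum => i _; apply: rpredZ; rewrite dhomogX /= mdeg1. Qed.

Lemma linform_eval a (x : 'rV[k]_m) : (linform a).@[x 0] = (x *m a) 0 0.
Proof.
rewrite /linform raddf_sum mxE; apply: eq_bigr => i _.
by rewrite /= mevalZ mevalXU mulrC.
Qed.

Lemma linformD a b : linform (a + b) = linform a + linform b.
Proof. by rewrite -big_split; apply: eq_bigr => i _; rewrite mxE scalerDl. Qed.

Lemma linformZ c a : linform (c *: a) = c *: linform a.
Proof. by rewrite scaler_sumr; apply: eq_bigr => i _; rewrite mxE scalerA. Qed.

Lemma linform_mul r (M : 'M_(m, r)) (b : 'cV_r) :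
  linform (M *m b) = \sum_j b j 0 *: linform (col j M).
Proof.
under [RHS]eq_bigr do rewrite scaler_sumr; rewrite exchange_big.
apply: eq_bigr => i _; rewrite mxE scaler_suml; apply: eq_bigr => j _.
by rewrite mxE scalerA mulrC.
Qed.

Lemma linform_delta i : linform (delta_mx i 0) = 'X_i.
Proof.
rewrite /linform (bigD1 i) //= mxE !eqxx scale1r big1 ?addr0 // => j /negPf ji.
by rewrite mxE ji scale0r.
Qed.
End LinearForms.

Lemma restrictC (k : closedFieldType) n (u v : 'rV[k]_n.+1) c :
  restrict_to_line u v c%:MP = c%:P.
Proof. exact: mmapC. Qed.

Lemma restrictX (k : closedFieldType) n (u v : 'rV[k]_n.+1) i :
  restrict_to_line u v 'X_i = (u 0 i)%:P + v 0 i *: 'X.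
Proof. by rewrite /restrict_to_line mmapX mmap1U. Qed.

Lemma restrictZ (k : closedFieldType) n (u v : 'rV[k]_n.+1) c f :
  restrict_to_line u v (c *: f) = c *: restrict_to_line u v f.
Proof. by rewrite /restrict_to_line mmapZ mul_polyC. Qed.

Lemma restrict_linform (k : closedFieldType) n (u v : 'rV[k]_n.+1) a :
  restrict_to_line u v (linform a) = ((u *m a) 0 0)%:P + ((v *m a) 0 0) *: 'X.
Proof.
rewrite rmorph_sum !mxE rmorph_sum scaler_suml -big_split; apply: eq_bigr => i _ /=.
by rewrite restrictZ restrictX scalerDr scalerA -mul_polyC -rmorphM !(mulrC (a _ _)).
Qed.

Lemma horner_restrict (k : closedFieldType) n (u v : 'rV[k]_n.+1) f t :
  (restrict_to_line u v f).[t] = f.@[(u + t *: v) 0].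
Proof.
elim/mpoly_ring_ind: f => [c|i|f g IHf IHg|f g IHf IHg].
- by rewrite restrictC hornerC mevalC.
- by rewrite restrictX hornerD hornerC hornerZ hornerX mevalXU !mxE mulrC.
- by rewrite rmorphD hornerD mevalD IHf IHg.
- by rewrite rmorphM hornerM mevalM IHf IHg.
Qed.

(** * The kernel of restriction to the centre *)

(** [frame] says that every x is (x A) P + lam(x) q: the columns of A and lam
    are a basis of the linear forms. *)
Section Frame.
Variables (k : closedFieldType) (n : nat).
Variables (q : 'rV[k]_n.+1) (A : 'M[k]_(n.+1, n)) (P : 'M[k]_(n, n.+1)) (lam : 'cV[k]_n.+1).
Hypotheses (frame : A *m P + lam *m q = 1%:M) (qA : q *m A = 0) (qlam : q *m lam = 1%:M).
Local Notation R := {mpoly k[n.+1]}.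
Let Y j := linform (col j A).
Local Notation ev := (restrict_to_line 0 q).

Lemma restrict_center_coord j : ev (Y j) = 0.
Proof.
rewrite restrict_linform mul0mx mxE; have -> : q *m col j A = 0.
  by rewrite colE mulmxA qA mul0mx.
by rewrite mxE scale0r addr0.
Qed.

Lemma restrict_center_lam : ev (linform lam) = 'X.
Proof. by rewrite restrict_linform mul0mx qlam !mxE eqxx scale1r add0r. Qed.

Lemma restrict_center_homog d f : f \is d.-homog -> ev f = f.@[q 0] *: 'X^d.
Proof.
move=> fh; transitivity (mmap (@polyC k) (fun i => 'X * (q 0 i)%:P) f).
  rewrite /restrict_to_line /mmap; apply: eq_bigr => u _; congr (_ * _).
  by apply: eq_bigr => i _; rewrite mxE add0r mulrC mul_polyC.
rewrite (mmap_scale _ _ _ fh) mulrC -mul_polyC; congr (_ * _).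
elim/mpoly_ring_ind: {fh}f => [c|i|f g IHf IHg|f g IHf IHg].
- by rewrite mmapC mevalC.
- by rewrite mmapX mmap1U mevalXU.
- by rewrite !rmorphD /= IHf IHg.
- by rewrite !rmorphM /= IHf IHg.
Qed.

(** Replacing every Y_j by 0 is the substitution x |-> lam(x) q, and it depends
    on f only through its restriction to the line of q. *)
Lemma restrict_center_kernel f : ev f = 0 -> in_span Y (fun=> True) f.
Proof.
pose h : {rmorphism R -> R} := mmap (@mpolyC n.+1 k) (fun i => q 0 i *: linform lam).
have hE g : h g = (map_poly (@mpolyC n.+1 k) (ev g)).[linform lam].
  elim/mpoly_ring_ind: g => [c|i|f1 g IHf IHg|f1 g IHf IHg].
  - by rewrite /h /= mmapC restrictC map_polyC hornerC.
  - rewrite /h /= mmapX mmap1U restrictX mxE add0r map_polyZ map_polyX hornerZ hornerX.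
    by rewrite mul_mpolyC.
  - by rewrite !rmorphD /= hornerD IHf IHg.
  - by rewrite !rmorphM /= hornerM IHf IHg.
move=> f0; have -> : f = f - h f by rewrite hE f0 rmorph0 horner0 subr0.
apply: sub_retract_span => [c|i]; first by rewrite /h /= mmapC.
rewrite /h /= mmapX mmap1U; exists (fun j => (P j i)%:MP) => //.
transitivity (linform (A *m P *m delta_mx i 0)).
  have <- : 1%:M - lam *m q = A *m P by rewrite -frame addrK.
  rewrite mulmxBl mul1mx -mulmxA.
  have -> : q *m (delta_mx i 0 : 'cV_n.+1) = (q 0 i)%:M.
    by rewrite -colE; apply/matrixP => a b; rewrite !mxE !ord1 eqxx.
  by rewrite mul_mx_scalar linformD linform_delta -(scaleNr _ lam) linformZ scaleNr.
rewrite -mulmxA linform_mul; apply: eq_bigr => j _.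
by rewrite mulrC mul_mpolyC -colE mxE.
Qed.
End Frame.

(** * Multiplication by lam on the relations over the Y_j *)

Section Syzygies.
Variables (k : closedFieldType) (n : nat).
Variables (q : 'rV[k]_n.+1) (A : 'M[k]_(n.+1, n)) (P : 'M[k]_(n, n.+1)) (lam : 'cV[k]_n.+1).
Hypotheses (frame : A *m P + lam *m q = 1%:M) (qA : q *m A = 0) (qlam : q *m lam = 1%:M).
Local Notation R := {mpoly k[n.+1]}.
Let Y j := linform (col j A).
Local Notation ev := (restrict_to_line 0 q).

(** Injectivity of lam on Tor_1^S(R/I, k)_j.  A lift of lam kap to F_1 through
    lam times a lift of kap, and another one through the Y_l, differ by a
    syzygy of degree j + 1; the vanishing of Tor_2 writes it with coefficients
    in (X_0, ..., X_n), that is, up to (Y_1, ..., Y_n), as lam times a syzygy.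
    Subtracting this syzygy from the lift of kap leaves an element of
    (Y_1, ..., Y_n) F_1. *)
Lemma span_of_lam_mul_span (I : R -> Prop) (F : graded_free_resolution I) kap j :
  homogeneous_ideal I -> (forall f, I f -> f@_0 = 0) ->
  Tor_vanishes F 2 j.+1 -> I kap -> kap \is j.-homog ->
  in_span Y I (linform lam * kap) -> in_span Y I kap.
Proof.
move=> [Iid Ihom] Iirr tor Ikap kaph [iota Iiota kapE].
have [I0 ID IM] := Iid.
(* F_0 need not be R, so 1 is only lifted modulo I; that the constant term of
   the lift is 1 suffices, because components of degree j are taken below. *)
have [v1 Iv1] := aug_surj F 1.
have eps1 : ((v1 *m aug F) 0 0)@_0 = 1.
  by have /eqP := Iirr _ Iv1; rewrite raddfB /= mcoeff1 eqxx subr_eq0 => /eqP.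
have lift f : I f -> exists w, f *: v1 = w *m diff F 0.
  move=> If; apply/exact_0; rewrite -scalemxAl mxE mulrC; exact: IM.
have [w0 w0E] := lift _ Ikap.
have [wY wYE] := fin_all_exists (fun l => lift _ (Iiota l)).
pose sh i := @res_shift _ _ _ F i.
pose w := homog_component (sh 1%N) j w0.
have kapw : (w *m diff F 0 *m aug F) 0 0 = kap.
  rewrite -(homog_component_mulmx _ _ (@diff_homog _ _ _ F 0)) -w0E.
  have augh a (b : 'I_1) (u : 'X_{1..n.+1}) :
    u \in msupp (aug F a b) -> (mdeg u + 0)%N = res_shift a.
    by rewrite ord1 addn0; exact: aug_homog.
  rewrite -(homog_component_mulmx (shs := fun=> 0%N) _ _ augh) mxE subn0 -scalemxAl mxE.
  by rewrite mulrC (pihomogM _ _ kaph) leqnn subnn pihomog_mdeg0 eps1 mpolyC1 mul1r.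
pose sig := linform lam *: w0 - \sum_l Y l *: wY l.
have [tau0 tau0E] : exists tau, sig = tau *m diff F 1.
  apply/exact_S; rewrite mulmxBl -scalemxAl -w0E scalerA kapE scaler_suml mulmx_suml.
  by rewrite -sumrB big1 // => l _; rewrite -scalemxAl -wYE scalerA subrr.
pose tau := homog_component (sh 2) j.+1 tau0.
pose W := \sum_l Y l *: homog_component (sh 1%N) j (wY l).
have tauE : linform lam *: w - W = tau *m diff F 1.
  rewrite /tau -(homog_component_mulmx _ _ (@diff_homog _ _ _ F 1)) -tau0E homog_componentB.
  rewrite homog_component_sum.
  rewrite homog_componentZ ?linform_homog //; congr (_ - _); apply: eq_bigr => l _.
  by rewrite homog_componentZ ?linform_homog.
have lin0 a f : (linform a * f : R)@_0 = 0.
  rewrite rmorphM /= (_ : (linform a)@_0 = 0) ?mul0r //.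
  by apply: dhomog_nemf_coeff (linform_homog a) _; rewrite /= mdeg0.
(* The constant part of tau is a cycle of degree j + 1 in the complex F (x) k,
   hence a boundary. *)
have [rho _ rhoE] : exists2 rho : 'rV[k]_(res_rank F 3), in_degree (i := 3) j.+1 rho
    & map_mx (mcoeff 0%MM) tau = rho *m diff_k F 2.
  apply: tor => [a|].
    rewrite !mxE; case: ifP => [le|]; last by rewrite mcoeff0 eqxx.
    have [d0|ne] := eqVneq (j.+1 - sh 2 a)%N 0%N.
      move=> _; apply/eqP; rewrite eqn_leq le /=; by rewrite -subn_eq0 d0.
    by rewrite (dhomog_nemf_coeff (pihomogP _ _ _)) ?eqxx //= mdeg0 eq_sym.
  rewrite /= /diff_k -map_mxM /= -tauE; apply/rowP => a; rewrite !mxE summxE.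
  rewrite raddfB /= lin0 raddf_sum big1 ?subr0 // => l _.
  by rewrite /= mxE lin0.
pose tau' := tau - map_mx (@mpolyC n.+1 k) rho *m diff F 2.
have tau'E : tau' *m diff F 1 = linform lam *: w - W.
  rewrite mulmxBl -tauE [X in _ - X](_ : _ = 0) ?subr0 //.
  by apply/exact_S; eexists.
have [T TE] : exists T : 'I_n.+1 -> 'rV[R]_(res_rank F 2), tau' = \sum_i 'X_i *: T i.
  have tau'0 a : (tau' 0 a)@_0 = 0.
    transitivity ((map_mx (mcoeff 0%MM) tau - rho *m diff_k F 2) 0 a); last first.
      by rewrite rhoE subrr mxE.
    rewrite !mxE !raddfB /=; congr (_ - _); rewrite raddf_sum; apply: eq_bigr => b _.
    by rewrite /= rmorphM /= !mxE mpolyCK.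
  have /fin_all_exists [g gE] a : exists g : 'I_n.+1 -> R, tau' 0 a = \sum_i 'X_i * g i.
    by have [g _ ->] := irrelevant_span (tau'0 a); exists g.
  exists (fun i => \row_a g a i); apply/rowP => a; rewrite gE summxE.
  by apply: eq_bigr => i _; rewrite !mxE.
(* X_i is congruent to q_i lam modulo the Y_l, so lam sig0 is the part of the
   syzygy that survives modulo the Y_l. *)
pose sig0 := (\sum_i (q 0 i)%:MP *: T i) *m diff F 1.
have evw a : ev ((w - sig0) 0 a) = 0.
  have /rowP/(_ a)/(congr1 ev) := tau'E.
  rewrite TE mulmx_suml summxE.
  have -> : ev ((linform lam *: w - W) 0 a) = 'X * ev (w 0 a).
    rewrite !mxE rmorphB rmorphM /= (restrict_center_lam qlam) summxE rmorph_sum.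
    rewrite big1 ?subr0 // => l _.
    by rewrite mxE rmorphM /= (restrict_center_coord qA) mul0r.
  have -> : ev (\sum_i ('X_i *: T i *m diff F 1) 0 a) = 'X * ev (sig0 0 a).
    rewrite /sig0 mulmx_suml summxE !rmorph_sum mulr_sumr; apply: eq_bigr => i _.
    rewrite -!scalemxAl !mxE !rmorphM /= restrictX mxE add0r restrictC.
    by rewrite -mul_polyC mulrCA mulrA.
  move=> /eqP; rewrite eq_sym -subr_eq0 -mulrBr mulf_eq0 polyX_eq0 /=.
  by rewrite -rmorphB /= !mxE => /eqP.
have [g gE] : exists g : 'I_n -> 'rV[R]_(res_rank F 1), w - sig0 = \sum_l Y l *: g l.
  have /fin_all_exists [g gE] a : exists g : 'I_n -> R, (w - sig0) 0 a = \sum_l Y l * g l.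
    by have [g _ ->] := restrict_center_kernel frame (evw a); exists g.
  exists (fun l => \row_a g a l); apply/rowP => a; rewrite gE summxE.
  by apply: eq_bigr => l _; rewrite !mxE.
exists (fun l => (g l *m diff F 0 *m aug F) 0 0) => [l|].
  by apply/exact_0; exists (g l).
have <- : ((w - sig0) *m diff F 0 *m aug F) 0 0 = kap.
  rewrite mulmxBl (_ : sig0 *m diff F 0 = 0) ?subr0 //.
  by apply/exact_S; eexists.
rewrite gE !mulmx_suml summxE; apply: eq_bigr => l _.
by rewrite -!scalemxAl mxE.
Qed.
End Syzygies.

(** * Quadrics of the ideal on a line through the centre *)

Section Homogeneous.
Variables (k : closedFieldType) (m : nat).
Local Notation R := {mpoly k[m]}.

Lemma in_span_homog r (y : 'I_r -> R) (I : R -> Prop) d f :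
  (forall j, y j \is 1.-homog) -> (forall g, I g -> I (pihomog mdeg d g)) ->
  f \is d.+1.-homog -> in_span y I f ->
  in_span y (fun g => I g /\ g \is d.-homog) f.
Proof.
move=> yh Ih fh [g Ig fE]; exists (fun j => pihomog mdeg d (g j)) => [j|].
  by split; [exact: Ih | exact: pihomogP].
rewrite -(pihomog_dE fh) fE linear_sum; apply: eq_bigr => j _.
by rewrite /= [y j * g j]mulrC (pihomogM _ _ (yh j)) /= subn1 mulrC.
Qed.

Lemma homog_const0 d (f : R) : f \is d.+1.-homog -> f@_0 = 0.
Proof. by move=> fh; apply: dhomog_nemf_coeff fh _; rewrite /= mdeg0. Qed.

Lemma homogS_span d (f : R) : f \is d.+1.-homog ->
  exists2 g : 'I_m -> R, (forall i, g i \is d.-homog) & f = \sum_i 'X_i * g i.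
Proof.
move=> fh; have := irrelevant_span (homog_const0 fh).
case/(in_span_homog (d := d)) => // [i|g gh ->]; first by rewrite dhomogX /= mdeg1.
by exists g => // i; have [] := gh i.
Qed.

Lemma homog1_linform (f : R) : f \is 1.-homog -> exists a, f = linform a.
Proof.
case/homogS_span => g gh ->; exists (\col_i (g i)@_0).
apply: eq_bigr => i _; rewrite mxE -[in LHS](pihomog_dE (gh i)) pihomog_mdeg0.
by rewrite mulrC mul_mpolyC.
Qed.

Lemma generated_homog_lt2 (I : R -> Prop) d f : generated_by_quadrics I -> I f ->
  f \is d.-homog -> (d < 2)%N -> f = 0.
Proof.
move=> gen If /pihomog_dE <- lt; have [r [a [g [gh ->]]]] := gen f If.
rewrite linear_sum big1 // => i _; have [gi _] := gh i.
by rewrite /= (pihomogM _ _ gi) leqNgt lt.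
Qed.

Lemma generated_const0 (I : R -> Prop) f : generated_by_quadrics I -> I f -> f@_0 = 0.
Proof.
move=> gen If; have [r [a [g [gh ->]]]] := gen f If.
rewrite raddf_sum big1 // => i _; have [gi _] := gh i.
by rewrite /= rmorphM /= (homog_const0 gi) mulr0.
Qed.

End Homogeneous.

(** C is not assumed symmetric, and its two off-diagonal products are kept apart,
    so that no division by 2 occurs. *)
Lemma quadric_matrix (k : closedFieldType) n (f : {mpoly k[n.+1]}) : f \is 2.-homog ->
  exists2 C : 'M[k]_n.+1, forall u : 'rV[k]_n.+1, f.@[u 0] = (u *m C *m u^T) 0 0
    & forall u v : 'rV[k]_n.+1, restrict_to_line u v f = (f.@[u 0])%:P
      + ((u *m C *m v^T) 0 0 + (v *m C *m u^T) 0 0) *: 'X + (f.@[v 0]) *: 'X^2.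
Proof.
case/homogS_span => g gh ->.
have /fin_all_exists [a gE] i : exists a, g i = linform a by apply: homog1_linform.
pose C := \matrix_(i, j) a j i 0.
have aC (w : 'rV[k]_n.+1) i : (w *m a i) 0 0 = (w *m C) 0 i.
  by rewrite !mxE; apply: eq_bigr => j _; rewrite mxE.
have evE (w : 'rV[k]_n.+1) : (\sum_i 'X_i * g i).@[w 0] = (w *m C *m w^T) 0 0.
  rewrite raddf_sum mxE; apply: eq_bigr => i _ /=.
  by rewrite mevalM mevalXU gE linform_eval aC [w^T _ _]mxE mulrC.
exists C => // u v; rewrite !evE !(mxE, raddf_sum) -big_split !scaler_suml -!big_split /=.
apply: eq_bigr => i _; rewrite rmorphM /= restrictX gE restrict_linform !aC !mxE.
rewrite -!mul_polyC !rmorphD !rmorphM /=; ring.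
Qed.

Section LinearSyzygies.
Variables (k : closedFieldType) (n : nat).
Variables (q : 'rV[k]_n.+1) (A : 'M[k]_(n.+1, n)) (P : 'M[k]_(n, n.+1)) (lam : 'cV[k]_n.+1).
Hypotheses (frame : A *m P + lam *m q = 1%:M) (qA : q *m A = 0) (qlam : q *m lam = 1%:M).
Local Notation R := {mpoly k[n.+1]}.
Let Y j := linform (col j A).
Local Notation ev := (restrict_to_line 0 q).

Variables (I : R -> Prop) (f1 : R).
Hypotheses (Ihom : homogeneous_ideal I) (Igen : generated_by_quadrics I).
Hypothesis linear_syzygies : forall kap j, (3 <= j)%N -> I kap -> kap \is j.-homog ->
  in_span Y I (linform lam * kap) -> in_span Y I kap.
Hypotheses (If1 : I f1) (f1h : f1 \is 2.-homog) (f1q : f1.@[q 0] = 1).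

(** Since lam^2 is congruent to f1 modulo the Y_j, the product lam^2 kap is in
    (Y_1, ..., Y_n) I, and lam can be cancelled twice. *)
Lemma center_kernel_span kap j : (3 <= j)%N -> I kap -> kap \is j.-homog -> ev kap = 0 ->
  in_span Y I kap.
Proof.
move=> j3 Ik kh k0; have [Iid _] := Ihom; have [_ _ IM] := Iid.
have l1 := linform_homog lam.
apply: (linear_syzygies j3) => //.
apply: (@linear_syzygies _ j.+1); [exact: leqW | exact: IM | exact: (dhomogM l1 kh) |].
have -> : linform lam * (linform lam * kap) = (linform lam ^+ 2 - f1) * kap + kap * f1 by ring.
apply: in_spanD => //; apply: in_spanMr => //; apply: (restrict_center_kernel frame) => //.
rewrite rmorphB rmorphXn /= (restrict_center_lam qlam) (restrict_center_homog _ f1h).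
by rewrite f1q scale1r subrr.
Qed.

Lemma center_kernel_span_homog kap d : (2 <= d)%N -> I kap -> kap \is d.+1.-homog -> ev kap = 0 ->
  in_span Y (fun g => I g /\ g \is d.-homog) kap.
Proof.
move=> d2 Ik kh k0; apply: in_span_homog => // [j|g|]; first exact: linform_homog.
  by apply: (proj2 Ihom).
exact: center_kernel_span Ik kh k0.
Qed.

Variable u : 'rV[k]_n.+1.
Local Notation ru := (restrict_to_line u q).
Hypothesis u_polar : forall kap, I kap -> kap \is 2.-homog -> kap.@[q 0] = 0 -> (ru kap)`_1 = 0.

Lemma restrict_quadric f : f \is 2.-homog ->
  ru f = (f.@[u 0])%:P + (ru f)`_1 *: 'X + f.@[q 0] *: 'X^2.
Proof.
case/quadric_matrix => C _ ->; congr (_ + _ *: _ + _).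
by rewrite !coefD !coefZ coefX coefXn coefC /= mulr1 mulr0 add0r addr0.
Qed.

Lemma restrict_coord j : ru (Y j) = (Y j).@[u 0]%:P.
Proof.
rewrite restrict_linform linform_eval (_ : q *m col j A = 0) ?mxE ?scale0r ?addr0 //.
by rewrite colE mulmxA qA mul0mx.
Qed.

Lemma restrict_lam : ru (linform lam) = (linform lam).@[u 0]%:P + 'X.
Proof. by rewrite restrict_linform linform_eval qlam !mxE eqxx scale1r. Qed.

Lemma reduce_quadric f : I f -> f \is 2.-homog ->
  let g := f - f.@[q 0] *: f1 in [/\ I g, g \is 2.-homog & g.@[q 0] = 0].
Proof.
move=> If fh g; have [[_ ID IM] _] := Ihom; split.
- by apply: ID => //; rewrite -scaleNr -mul_mpolyC; apply: IM.
- by rewrite rpredB // rpredZ.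
- by rewrite mevalB mevalZ f1q mulr1 subrr.
Qed.

(** On the line the quadric is constant, equal to kap(u).  The cubic lam kap is
    in (Y_1, ..., Y_n) I, hence a combination of quadrics of I with coefficients
    that are constant on the line; modulo constants these are multiples of f1,
    so comparing the coefficients of t^2, then of t, gives kap(u) = 0. *)
Lemma restrict_reduced_quadric kap : I kap -> kap \is 2.-homog -> kap.@[q 0] = 0 -> ru kap = 0.
Proof.
move=> Ik kh kq; have [[_ _ IM] _] := Ihom.
have kuE := restrict_quadric kh; rewrite (u_polar Ik kh kq) kq !scale0r !addr0 in kuE.
have lh : linform lam * kap \is 3.-homog by apply: (dhomogM (linform_homog _)).
have [//||g gP E] := @center_kernel_span_homog (linform lam * kap) 2 _ (IM _ _ Ik) lh.
  by rewrite rmorphM /= (restrict_center_homog _ kh) kq scale0r mulr0.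
pose c := \sum_j (Y j).@[u 0] * (g j).@[q 0].
(* As u is in the polar space, the quadric g_j - g_j(q) f1 has no linear term. *)
have B1 j : (ru (g j))`_1 = (g j).@[q 0] * (ru f1)`_1.
  have [Ig gh] := gP j; have [Ir rh rq] := reduce_quadric Ig gh.
  have /eqP := u_polar Ir rh rq; rewrite rmorphB /= restrictZ coefB coefZ subr_eq0.
  by move/eqP.
have {}E : ((linform lam).@[u 0]%:P + 'X) * kap.@[u 0]%:P = \sum_j (Y j).@[u 0] *: ru (g j).
  rewrite -kuE -restrict_lam -rmorphM E rmorph_sum; apply: eq_bigr => j _.
  by rewrite rmorphM /= restrict_coord mul_polyC.
have c0 : c = 0.
  transitivity ((\sum_j (Y j).@[u 0] *: ru (g j))`_2).
    rewrite coef_sum; apply: eq_bigr => j _; have [_ gh] := gP j.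
    rewrite (restrict_quadric gh) coefZ !coefD !coefZ coefX coefXn coefC /=.
    by rewrite mulr0 mulr1 !add0r.
  by rewrite -E coefMC coefD coefC coefX addr0 mul0r.
have {E} : (((linform lam).@[u 0]%:P + 'X) * kap.@[u 0]%:P)`_1 = c * (ru f1)`_1.
  rewrite E coef_sum mulr_suml; apply: eq_bigr => j _.
  by rewrite coefZ B1 mulrA.
rewrite c0 mul0r coefMC coefD coefC coefX /= add0r mul1r kuE => ->.
by rewrite polyC0.
Qed.

(** In degree at least 3, subtracting a multiple of lam^(d-2) f1 makes f vanish
    on the line of q; the rest is in (Y_1, ..., Y_n) I, and the Y_j are constant
    on the line, so the degree drops. *)
Lemma dvdp_restrict_homog f d : I f -> f \is d.-homog -> ru f1 %| ru f.
Proof.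
have [[_ ID IM] _] := Ihom.
elim: d f => [|d IH] f If fh; first by rewrite (generated_homog_lt2 Igen If fh) // rmorph0 dvdp0.
case: d => [|[|d]] in IH fh *.
- by rewrite (generated_homog_lt2 Igen If fh) // rmorph0 dvdp0.
- have [Ig gh gq] := reduce_quadric If fh.
  have /eqP := restrict_reduced_quadric Ig gh gq.
  by rewrite rmorphB subr_eq0 /= restrictZ => /eqP ->; rewrite -mul_polyC dvdp_mull.
pose g := f - f.@[q 0] *: (linform lam ^+ d.+1 * f1).
have lh : linform lam ^+ d.+1 * f1 \is d.+3.-homog.
  rewrite -[d.+3]addn2 -[d.+1 in X in X.-homog]mul1n.
  by apply: dhomogM => //; apply: dhomogMn; apply: linform_homog.
have Ig : I g by apply: ID => //; rewrite -scaleNr -mul_mpolyC; apply: (IM); apply: IM.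
have gh : g \is d.+3.-homog by rewrite rpredB // rpredZ.
have [||iota iotaP gE] := @center_kernel_span_homog g d.+2 _ Ig gh => //.
  rewrite (restrict_center_homog _ gh) mevalB mevalZ mevalM f1q rmorphXn /= linform_eval qlam.
  by rewrite mxE expr1n !mulr1 subrr scale0r.
have -> : f = g + f.@[q 0] *: (linform lam ^+ d.+1 * f1) by rewrite subrK.
rewrite rmorphD /= restrictZ rmorphM; apply: dvdp_add; last first.
  by rewrite -mul_polyC !dvdp_mull.
rewrite gE rmorph_sum; apply: (big_ind (fun p => ru f1 %| p)) => [|p p'|j _]; first exact: dvdp0.
  exact: dvdp_add.
by rewrite rmorphM dvdp_mull //; apply: IH; have [] := iotaP j.
Qed.

Lemma dvdp_restrict f : I f -> ru f1 %| ru f.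
Proof.
move=> If; rewrite (pihomog_partitionE (leqnn (mmeasure mdeg f))) rmorph_sum.
apply: (big_ind (fun p => ru f1 %| p)) => [|p p'|j _]; [exact: dvdp0|exact: dvdp_add|].
by apply: (@dvdp_restrict_homog _ j) (pihomogP _ _ _); apply: (proj2 Ihom).
Qed.

End LinearSyzygies.

(** * Linear subspaces, colength and vanishing ideals *)

(** Enlarge a matrix whose row space lies in S until the two agree; the rank
    bounds the number of steps. *)
Lemma linear_subspace_mx (k : closedFieldType) m (S : 'rV[k]_m -> Prop) :
  S 0 -> (forall a u v, S u -> S v -> S (a *: u + v)) ->
  exists M : 'M[k]_m, forall u, S u <-> (u <= M)%MS.
Proof.
move=> S0 SL.
suff H d (M : 'M[k]_m) : (forall u : 'rV_m, (u <= M)%MS -> S u) -> (m - \rank M <= d)%N ->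
  exists M : 'M[k]_m, forall u, S u <-> (u <= M)%MS.
  apply: (H m 0) => [u|]; last exact: leq_subr.
  by rewrite submx0 => /eqP ->.
elim: d M => [|d IH] M MS le.
  exists M => u; split=> [_|/MS //]; apply: submx_full.
  by rewrite /row_full eqn_leq rank_leq_col -subn_eq0 -leqn0.
have [SM|/not_all_ex_not [u Su]] := classic (forall u, S u -> (u <= M)%MS).
  by exists M => u; split; [exact: SM | exact: MS].
have {Su} [Su /negP uM] := imply_to_and _ _ Su.
apply: (IH (M + u)%MS) => [v /sub_addsmxP [[D1 D2] /= ->]|].
  rewrite [D2]mx11_scalar mul_scalar_mx addrC; apply: SL => //.
  by apply: MS; apply: submxMl.
have lt : (\rank M < \rank (M + u))%N.
  rewrite rank_ltmx // ltmxE addsmxSl /=; apply: contra uM.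
  by apply: submx_trans; apply: addsmxSr.
by rewrite -ltnS (leq_trans _ le) // ltn_sub2l // (leq_trans lt) // rank_leq_row.
Qed.

(** With a the root of p, the value at a is injective on k[t]/(p). *)
Lemma colength_lt2 (k : closedFieldType) (J : {poly k} -> Prop) p :
  (forall s, J (s * p)) -> size p = 2%N -> ~ colength_ge 2 J.
Proof.
move=> Jp sp [v vfree].
have [|a /factor_theorem [b pE]] := closed_rootP p _; first by rewrite sp.
have b0 : b != 0 by apply: contra_eqN sp => /eqP b0; rewrite pE b0 mul0r size_poly0.
have /size_poly1P [c c0 bE] : size b == 1%N.
  by move: sp; rewrite pE size_Mmonic ?monicXsubC // size_XsubC addn2 => -[->].
have Jroot f : root f a -> J f.
  move/factor_theorem => [s ->]; have -> : s * ('X - a%:P) = (s * c^-1%:P) * p.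
    by rewrite pE bE -mulrA [c^-1%:P * _]mulrA -polyCM mulVf // mul1r.
  exact: Jp.
have no (w : 'I_2 -> k) : \sum_i w i * (v i).[a] = 0 -> forall i, w i = 0.
  move=> w0; apply: vfree; apply: Jroot; rewrite /root horner_sum -[X in _ == X]w0; apply/eqP.
  by apply: eq_bigr => i _; rewrite hornerZ.
have v0 : (v 0).[a] = 0.
  apply/eqP; rewrite -oppr_eq0; apply/eqP.
  apply: (no (fun i => if i == 0 then (v 1).[a] else - (v 0).[a]) _ 1).
  rewrite !big_ord_recl big_ord0 /= addr0.
  have -> : lift ord0 ord0 = 1 :> 'I_2 by apply: val_inj.
  by rewrite mulNr mulrC subrr.
suff /eqP : (fun i : 'I_2 => (i == 0)%:R : k) 0 = 0 by rewrite /= oner_eq0.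
apply: (no (fun i : 'I_2 => (i == 0)%:R) _ 0).
by rewrite !big_ord_recl big_ord0 /= v0 mulr0 mul0r !addr0.
Qed.

Lemma colength_ge2 (k : closedFieldType) (J : {poly k} -> Prop) g :
  (forall f, J f -> g %| f) -> size g = 3%N -> colength_ge 2 J.
Proof.
move=> Jg sg; exists (fun i => 'X^i) => c /Jg gd i.
have s2 : (size (\sum_(i < 2) c i *: 'X^i : {poly k})%R <= 2)%N.
  apply: leq_trans (size_sum _ _ _) _; apply/bigmax_leqP => j _.
  by rewrite (leq_trans (size_scale_leq _ _)) // size_polyXn.
have c0 : \sum_(i < 2) c i *: 'X^i = 0.
  by apply/eqP; apply: contraTT gd => nz; rewrite gtNdvdp // sg ltnS.
have := congr1 (fun p : {poly k} => p`_i) c0; rewrite coef0 coef_sum => <-.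
rewrite (bigD1 i) //= big1 ?addr0 => [|j /negPf ji]; rewrite coefZ coefXn.
  by rewrite eqxx mulr1.
by rewrite eq_sym -val_eqE /= in ji *; rewrite ji mulr0.
Qed.

Section ProjectiveVarieties.
Variables (k : closedFieldType) (m : nat).
Local Notation R := {mpoly k[m]}.
Implicit Type X : 'rV[k]_m -> Prop.

Lemma proj_closed_neq0 X x : proj_closed X -> X x -> x != 0.
Proof. by move=> [F _ ->] []. Qed.

Lemma proj_closedZ X c x : proj_closed X -> c != 0 -> X x -> X (c *: x).
Proof.
move=> [F Fh XE] c0 /XE [x0 Fx]; apply/XE; rewrite scaler_eq0 negb_or c0; split=> // f Ff.
by have [d fh] := Fh f Ff; rewrite (meval_scale _ _ fh) Fx // mulr0.
Qed.

Lemma closed_nonroot_neq0 (p : {poly k}) : p != 0 -> exists2 c, c != 0 & p.[c] != 0.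
Proof.
move=> p0; have [|c] := closed_nonrootP (p * 'X) _; first by rewrite mulf_neq0 ?polyX_eq0.
by rewrite /root hornerM hornerX mulf_eq0 negb_or => /andP [] *; exists c.
Qed.

(** At a point x of X, the values of the components of f are the coefficients
    of c |-> f(c x), a polynomial that vanishes for all c <> 0. *)
Lemma vanishing_homog X d f : proj_closed X -> vanishing_ideal X f ->
  vanishing_ideal X (pihomog mdeg d f).
Proof.
move=> Xcl fX x Xx; pose N := maxn d.+1 (mmeasure mdeg f).
pose p := \poly_(i < N) (pihomog mdeg i f).@[x 0].
have dN : (d < N)%N by rewrite leq_maxl.
have pE c : c != 0 -> p.[c] = 0.
  move=> c0; rewrite -(fX _ (proj_closedZ Xcl c0 Xx)).
  rewrite [in RHS](pihomog_partitionE (leq_maxr d.+1 (mmeasure mdeg f))) horner_poly raddf_sum.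
  by apply: eq_bigr => i _; rewrite /= (meval_scale _ _ (pihomogP _ _ _)) mulrC.
have [p0|/closed_nonroot_neq0 [c c0]] := eqVneq p 0; last by rewrite pE ?eqxx.
by have := coef_poly N (fun i => (pihomog mdeg i f).@[x 0]) d; rewrite -/p p0 coef0 dN.
Qed.

Variables (I : R -> Prop) (X : 'rV[k]_m -> Prop).
Hypotheses (Xcl : proj_closed X) (Ihom : homogeneous_ideal I) (IX : generates_ideal_sheaf I X).

Lemma neq0_coord (x : 'rV[k]_m) : x != 0 -> exists i, x 0 i != 0.
Proof.
move=> x0; apply/existsP; apply: contraNT x0; rewrite negb_exists => /forallP x0.
by apply/eqP/rowP => i; rewrite mxE; apply/eqP; rewrite -[_ == _]negbK.
Qed.

Lemma ideal_vanishes f : I f -> vanishing_ideal X f.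
Proof.
move=> If x Xx; rewrite (pihomog_partitionE (leqnn (mmeasure mdeg f))) raddf_sum big1 // => d _.
have [i xi] := neq0_coord (proj_closed_neq0 Xcl Xx).
apply: (proj1 (IX i (pihomogP _ d f)) _ x Xx xi); exists 0%N.
by rewrite expr0 mul1r; apply: (proj2 Ihom).
Qed.

Lemma ideal_zero_locus (x : 'rV[k]_m) : x != 0 -> (forall f, I f -> f.@[x 0] = 0) -> X x.
Proof.
move=> x0 Ix; have [F Fh XE] := Xcl; apply/XE; split=> // f Ff.
have [d fh] := Fh f Ff; have [i xi] := neq0_coord x0.
have [N IN] : exists N, I ('X_i ^+ N * f).
  by apply/(IX i fh) => z /XE [_ /(_ f Ff)].
have /eqP := Ix _ IN; rewrite mevalM rmorphXn /= mevalXU mulf_eq0 expf_eq0 (negPf xi) andbF.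
by move/eqP.
Qed.

End ProjectiveVarieties.

Lemma dvdp_coprime_mul2 (k : closedFieldType) (g a b h : {poly k}) :
  coprimep a b -> g %| a * h -> g %| b * h -> g %| h.
Proof.
move/Bezout_eq1_coprimepP => [[s t] /= st] ga gb.
by rewrite -[h]mul1r -st mulrDl -!mulrA dvdp_add // dvdp_mull.
Qed.

Section Saturation.
Variables (k : closedFieldType) (n : nat).
Local Notation R := {mpoly k[n.+1]}.
Variables (I : R -> Prop) (X : 'rV[k]_n.+1 -> Prop).
Hypotheses (Xcl : proj_closed X) (Ihom : homogeneous_ideal I) (IX : generates_ideal_sheaf I X).
Variables (u q : 'rV[k]_n.+1) (g : {poly k}).

(** The coordinates of u + t q are polynomials in t without common root, two of
    them being already coprime, so a power of them that multiplies f into I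
    does not affect divisibility on the line. *)
Lemma saturated_dvdp : q != 0 -> ~~ (u <= q)%MS ->
  (forall f, I f -> g %| restrict_to_line u q f) ->
  forall f, vanishing_ideal X f -> g %| restrict_to_line u q f.
Proof.
move=> q0 uq gI.
have [i qi] := neq0_coord q0.
have [j uj] : exists j, u 0 i * q 0 j - u 0 j * q 0 i != 0.
  apply/existsP; apply: contraNT uq; rewrite negb_exists => /forallP H.
  apply/sub_rVP; exists (u 0 i / q 0 i); apply/rowP => j; rewrite mxE.
  move: (H j); rewrite negbK subr_eq0 => /eqP E.
  by rewrite mulrAC E mulfK.
(* Bezout: the combination q_j l_i - q_i l_j is the minor, a nonzero constant. *)
pose l a := (u 0 a)%:P + q 0 a *: 'X : {poly k}.
have co : coprimep (l i) (l j).
  apply/Bezout_eq1_coprimepP; pose D := u 0 i * q 0 j - u 0 j * q 0 i.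
  exists ((q 0 j / D)%:P, (- q 0 i / D)%:P).
  transitivity ((D / D)%:P); last by rewrite divff.
  rewrite /= /l /D -!mul_polyC !(rmorphM, rmorphN, rmorphB) /=; ring.
move=> f fX; rewrite (pihomog_partitionE (leqnn (mmeasure mdeg f))) rmorph_sum.
apply: (big_ind (fun p => g %| p)) => [|p p'|d _]; [exact: dvdp0|exact: dvdp_add|].
have key a : exists N, g %| l a ^+ N * restrict_to_line u q (pihomog mdeg d f).
  have [N IN] : exists N, I ('X_a ^+ N * pihomog mdeg d f).
    by apply/(IX a (pihomogP _ d f)) => x Xx _; apply: vanishing_homog Xx.
  by exists N; have := gI _ IN; rewrite rmorphM rmorphXn /= restrictX.
have [[N gN] [M gM]] := (key i, key j).
by apply: dvdp_coprime_mul2 gN gM; rewrite coprimep_expl ?coprimep_expr.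
Qed.
End Saturation.

(** * The polar space of the centre *)

(** The coefficient of t in kap(u + t q) is the polar form of the quadric kap at
    (u, q), which is linear in u. *)
Definition polar_space (k : closedFieldType) n (q : 'rV[k]_n.+1) (I : {mpoly k[n.+1]} -> Prop) u :=
  forall kap, I kap -> kap \is 2.-homog -> kap.@[q 0] = 0 -> (restrict_to_line u q kap)`_1 = 0.

Section PolarSpace.
Variables (k : closedFieldType) (n : nat) (q : 'rV[k]_n.+1).
Local Notation R := {mpoly k[n.+1]}.
Implicit Types (u v : 'rV[k]_n.+1) (f : R).

Lemma polar_linear f : f \is 2.-homog -> forall a u v,
  (restrict_to_line (a *: u + v) q f)`_1
    = a * (restrict_to_line u q f)`_1 + (restrict_to_line v q f)`_1.
Proof.
case/quadric_matrix => C _ CE a u v; rewrite !CE !coefD !coefZ !coefX !coefXn !coefC /=.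
rewrite linearD linearZ /= !(mulmxDl, mulmxDr) -!scalemxAl -!scalemxAr !mxE; ring.
Qed.

Lemma polar_self f u : f \is 2.-homog -> (restrict_to_line u u f)`_1 = f.@[u 0] *+ 2.
Proof.
case/quadric_matrix => C fE ->; rewrite !coefD !coefZ !coefX !coefXn !coefC /= fE.
by rewrite mulr1 mulr0 addr0 add0r mulr2n.
Qed.

Variable I : R -> Prop.

Lemma polar_space_lin a u v : polar_space q I u -> polar_space q I v ->
  polar_space q I (a *: u + v).
Proof. by move=> hu hv f If fh fq; rewrite polar_linear // hu // hv // mulr0 addr0. Qed.

Lemma polar_space_center : polar_space q I q.
Proof. by move=> f If fh fq; rewrite polar_self // fq mul0rn. Qed.

Lemma polar_space0 : polar_space q I 0.
Proof.
move=> f If fh fq; have := polar_linear fh (-1) q q.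
by rewrite scaleN1r addNr mulN1r addNr.
Qed.

Lemma polar_spaceZ a u : polar_space q I u -> polar_space q I (a *: u).
Proof. by move=> hu; rewrite -[_ *: _]addr0; apply: polar_space_lin => //; apply: polar_space0. Qed.
End PolarSpace.

(** This is what makes the fibre ideal stable under multiplication by k[t]. *)
Lemma restrict_surj (k : closedFieldType) n (u q : 'rV[k]_n.+1) p : q != 0 ->
  exists f, restrict_to_line u q f = p.
Proof.
move=> /neq0_coord [i qi].
pose t : {mpoly k[n.+1]} := (q 0 i)^-1%:MP * ('X_i - (u 0 i)%:MP).
have tE : restrict_to_line u q t = 'X.
  rewrite rmorphM rmorphB /= restrictX !restrictC addrAC subrr add0r mul_polyC scalerA.
  by rewrite mulVf ?scale1r.
exists ((map_poly (@mpolyC n.+1 k) p).[t]).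
elim/poly_ind: p => [|p c IH]; first by rewrite rmorph0 horner0 rmorph0.
rewrite rmorphD rmorphM /= map_polyX map_polyC hornerMXaddC.
by rewrite rmorphD rmorphM /= restrictC tE IH.
Qed.

Lemma coef1_restrict (k : closedFieldType) n (x v : 'rV[k]_n.+1) f :
  (restrict_to_line x v f)`_1 = \sum_(i < n.+1) (f^`M(i)).@[x 0] * v 0 i.
Proof.
have c0 g : (restrict_to_line x v g)`_0 = g.@[x 0].
  by rewrite -horner_coef0 horner_restrict scale0r addr0.
elim/mpoly_ring_ind: f => [c|i|f g IHf IHg|f g IHf IHg].
- by rewrite restrictC coefC big1 // => i _; rewrite mderivC meval0 mul0r.
- rewrite restrictX coefD coefC coefZ coefX /= mulr1 add0r (bigD1 i) //= big1 => [|j /negPf ji].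
    have {1}-> : U_(i)%MM = (0 + U_(i))%MM by rewrite add0m.
    by rewrite mderivX addmK mpolyX0 mnmDE mnm1E eqxx mnm0E mevalZ meval1 !mul1r addr0.
  by rewrite mderivX mnm1E eq_sym ji scale0r meval0 mul0r.
- rewrite rmorphD coefD IHf IHg -big_split; apply: eq_bigr => i _.
  by rewrite mderivD mevalD mulrDl.
- rewrite rmorphM coefM 2!big_ord_recl big_ord0 /= addr0 !c0 IHf IHg.
  rewrite mulr_sumr mulr_suml -big_split; apply: eq_bigr => i _.
  by rewrite mderivM mevalD !mevalM /=; ring.
Qed.

(** * Fibres, the secant locus and the cokernel *)

Section Substitution.
Variables (k : closedFieldType) (a b : nat) (M : 'M[k]_(a, b)).

Definition linear_subst (f : {mpoly k[b]}) : {mpoly k[a]} :=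
  f \mPo [tuple linform (col j M) | j < b].

Lemma linear_subst_homog d f : f \is d.-homog -> linear_subst f \is d.-homog.
Proof.
move=> fh; rewrite -[d]muln1; apply: comp_mpoly_homog => // i.
by rewrite tnth_mktuple linform_homog.
Qed.

Lemma linear_subst_eval f (x : 'rV[k]_a) : (linear_subst f).@[x 0] = f.@[(x *m M) 0].
Proof.
rewrite comp_mpoly_meval; apply: meval_eq => j; rewrite tnth_mktuple linform_eval.
by rewrite colE mulmxA -colE mxE.
Qed.
End Substitution.

Lemma restrict_subst (k : closedFieldType) n b (M : 'M[k]_(n.+1, b)) (u q : 'rV[k]_n.+1) f :
  q *m M = 0 -> restrict_to_line u q (linear_subst M f) = (f.@[(u *m M) 0])%:P.
Proof.
move=> qM; elim/mpoly_ring_ind: f => [c|i|f g IHf IHg|f g IHf IHg].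
- by rewrite /linear_subst comp_mpolyC restrictC mevalC.
- rewrite /linear_subst comp_mpolyXU -tnth_nth tnth_mktuple restrict_linform mevalXU.
  rewrite !colE !mulmxA qM mul0mx -colE [col i _ _ _]mxE.
  by rewrite [(0 : 'M__) _ _]mxE scale0r addr0.
- by rewrite /linear_subst rmorphD rmorphD /= -!/(linear_subst _ _) IHf IHg mevalD rmorphD.
- by rewrite /linear_subst rmorphM rmorphM /= -!/(linear_subst _ _) IHf IHg mevalM rmorphM.
Qed.

Section SecantLocus.
Variables (k : closedFieldType) (n : nat) (X : 'rV[k]_n.+1 -> Prop).
Variables (q : 'rV[k]_n.+1) (A : 'M[k]_(n.+1, n)) (lam : 'cV[k]_n.+1).
Local Notation P := (pinvmx A).
Local Notation R := {mpoly k[n.+1]}.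
Hypotheses (frame : A *m P + lam *m q = 1%:M) (PA : P *m A = 1%:M) (qA : q *m A = 0).
Variables (I : R -> Prop) (f1 : R).
Hypotheses (X_closed : proj_closed X) (q_neq0 : q != 0) (q_notin_X : ~ X q).
Hypotheses (Ihom : homogeneous_ideal I) (IX : generates_ideal_sheaf I X).
Hypotheses (If1 : I f1) (f1h : f1 \is 2.-homog) (f1q : f1.@[q 0] = 1).
Hypothesis f1_dvdp : forall u, polar_space q I u ->
  forall f, I f -> restrict_to_line u q f1 %| restrict_to_line u q f.

Implicit Types (x u : 'rV[k]_n.+1) (y : 'rV[k]_n).

Lemma frame_eq x : x = x *m A *m P + (x *m lam) 0 0 *: q.
Proof.
rewrite -{1}[x]mulmx1 -frame mulmxDr !mulmxA; congr (_ + _).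
by rewrite {1}[x *m lam]mx11_scalar mul_scalar_mx.
Qed.

Lemma proj0_center x : x *m A = 0 -> (x <= q)%MS.
Proof. by move=> xA; rewrite [x]frame_eq xA mul0mx add0r scalemx_sub. Qed.

Lemma X_proj_neq0 x : X x -> x *m A != 0.
Proof.
move=> Xx; apply/eqP => /proj0_center /sub_rVP [c xE]; apply: q_notin_X.
have c0 : c != 0.
  apply: contraTneq (proj_closed_neq0 X_closed Xx) => c0.
  by rewrite xE c0 scale0r eqxx.
by rewrite -[q](scalerK c0) -xE; apply: proj_closedZ => //; rewrite invr_eq0.
Qed.

(** x and (x A) P span the same line with q, and q is in the polar space. *)
Lemma polar_space_proj x : polar_space q I x <-> polar_space q I (x *m A *m P).
Proof.
split=> hx; last first.
  by rewrite [x]frame_eq addrC; apply: polar_space_lin => //; apply: polar_space_center.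
have -> : x *m A *m P = - (x *m lam) 0 0 *: q + x by rewrite {3}[x]frame_eq addrC scaleNr addrK.
by apply: polar_space_lin => //; apply: polar_space_center.
Qed.

Lemma restrict_f1 u : restrict_to_line u q f1
  = (f1.@[u 0])%:P + (restrict_to_line u q f1)`_1 *: 'X + 'X^2.
Proof. by rewrite {1}(restrict_quadric q u f1h) f1q scale1r. Qed.

Lemma size_restrict_f1 u : size (restrict_to_line u q f1) = 3%N.
Proof.
rewrite restrict_f1 addrC size_polyDl size_polyXn //.
rewrite (leq_ltn_trans (size_polyD _ _)) // gtn_max ltnS (leq_trans (size_polyC_leq1 _)) //=.
by rewrite ltnS (leq_trans (size_scale_leq _ _)) // size_polyX.
Qed.

(** Off the polar space the fibre ideal contains a polynomial of degree 1; on it,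
    the ideal lies in that of a polynomial of degree 2. *)
Lemma fibre_ge2 y : y != 0 ->
  (fibre_length_ge q A X 2 y <-> polar_space q I (y *m P)).
Proof.
move=> y0; split=> [fib kap Ik kh kq|pol].
  apply: NNPP => /eqP c1.
  apply: (colength_lt2 _ _ fib (p := restrict_to_line (y *m P) q kap)) => [s|].
    have [h <-] := restrict_surj (y *m P) s q_neq0.
    exists (h * kap); last by rewrite rmorphM.
    by move=> x Xx; rewrite mevalM (ideal_vanishes X_closed Ihom IX Ik Xx) mulr0.
  rewrite (restrict_quadric q _ kh) kq scale0r addr0 addrC size_polyDl ?size_scale ?size_polyX //.
  by rewrite (leq_ltn_trans (size_polyC_leq1 _)).
apply: colength_ge2 (size_restrict_f1 (y *m P)) => _ [f fX ->].
apply: (saturated_dvdp X_closed IX q_neq0 _ _ fX); last exact: f1_dvdp.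
by apply: contra y0 => /sub_rVP [c yP]; rewrite -[y]mulmx1 -PA mulmxA yP -scalemxAl qA scaler0.
Qed.

(** The values of I at x are the values at t = 0 of multiples of f1(x + t q). *)
Lemma polar_quadric_in_X x : x != 0 -> polar_space q I x -> f1.@[x 0] = 0 -> X x.
Proof.
move=> x0 pol fx; apply: (ideal_zero_locus X_closed IX) => // f /(f1_dvdp pol) /dvdpP [s sE].
have := horner_restrict x q f 0; rewrite sE hornerM horner_restrict scale0r addr0 fx mulr0.
by move=> <-.
Qed.

Lemma secant_locusE x : secant_locus q A X x <-> [/\ x != 0, polar_space q I x & f1.@[x 0] = 0].
Proof.
split=> [[Xx /(fibre_ge2 (X_proj_neq0 Xx)) pol]|[x0 pol fx]].
  split; [exact: proj_closed_neq0 Xx | exact/polar_space_proj |].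
  exact: (ideal_vanishes X_closed Ihom IX If1 Xx).
have Xx := polar_quadric_in_X x0 pol fx; split=> //.
by apply/(fibre_ge2 (X_proj_neq0 Xx)); apply/(proj1 (polar_space_proj x)).
Qed.

(** Over any y in the projected polar space, a root of f1 on the line gives a
    point of X. *)
Lemma Z1E y : Z_1 q A X y <-> y != 0 /\ polar_space q I (y *m P).
Proof.
split=> [[[x Xx ->] /(fibre_ge2 (X_proj_neq0 Xx)) pol]|[y0 pol]].
  by split; first exact: X_proj_neq0.
split; last exact/fibre_ge2.
have [|a] := closed_rootP (restrict_to_line (y *m P) q f1) _; first by rewrite size_restrict_f1.
rewrite /root horner_restrict => /eqP fa; set x := _ + _ in fa.
have xA : x *m A = y by rewrite mulmxDl -scalemxAl qA scaler0 addr0 -mulmxA PA mulmx1.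
exists x => //; apply: polar_quadric_in_X fa.
  by apply: contra_neq y0 => x0; rewrite -xA x0 mul0mx.
by rewrite /x addrC; apply: polar_space_lin => //; apply: polar_space_center.
Qed.

(** The function lam/Y_j separates the fibre scheme over y, as t does.  If it
    were F/G near y with F, G forms on the target, then lam G - Y_j F, multiplied
    by forms v and G that are nonzero at y to kill it off the neighbourhood,
    would vanish on X and restrict to degree 1 on the fibre. *)
Lemma Z1_not_surjective y : Z_1 q A X y -> ~ stalk_surjective A X y.
Proof.
move=> [[x Xx yE] fib] surj; have y0 : y != 0 by rewrite yE X_proj_neq0.
have [j yj] := neq0_coord y0.
pose U (z : 'rV[k]_n) : Prop := z 0 j != 0.
have [||x' [Xx' Ux']|V [psi [Vop Vy VU psireg psiE]]] :=
    surj U (fun x => (x *m lam) 0 0 / (x *m A) 0 j).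
- exists (fun f => f = 'X_j) => [f ->|z]; first by exists 1%N; rewrite dhomogX /= mdeg1.
  split=> [zj|[_ [_ ->]]]; last by rewrite mevalXU.
  split; last by exists 'X_j; rewrite ?mevalXU.
  by apply: contra_neq zj => ->; rewrite mxE.
- exact: yj.
- exists 1%N, (linform lam), (linform (col j A)); rewrite !linform_homog; split=> //.
    by rewrite linform_eval colE mulmxA -colE mxE.
  by move=> z _ _; rewrite !linform_eval colE mulmxA -colE !mxE.
have [W Wh VE] := Vop; have [_ [v Wv vy]] := proj1 (VE y) Vy.
have [|d [F [G [Fh Gh Gy psiFG]]]] := psireg y; first by split=> //; exists x.
pose pl := linear_subst A.
pose f := pl v * pl G * (linform lam * pl G - pl 'X_j * pl F).
have fX : vanishing_ideal X f.
  move=> z Xz; rewrite /f !mevalM mevalB !mevalM !linear_subst_eval linform_eval mevalXU.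
  have [->|vz] := eqVneq (v.@[(z *m A) 0]) 0; first by rewrite !mul0r.
  have [->|Gz] := eqVneq (G.@[(z *m A) 0]) 0; first by rewrite mulr0 mul0r.
  have Vz : V (z *m A) by apply/VE; split; [exact: X_proj_neq0 | exists v].
  have := psiE z Xz Vz; rewrite psiFG //; last by split=> //; exists z.
  move/eqP; rewrite eqr_div //; last exact: VU Vz.
  by move=> /eqP ->; rewrite [F.@[_] * _]mulrC subrr mulr0.
apply: (colength_lt2 _ _ fib (p := restrict_to_line (y *m P) q f)) => [s|].
  have [h <-] := restrict_surj (y *m P) s q_neq0.
  exists (h * f); last by rewrite [RHS]rmorphM.
  by move=> z Xz; rewrite mevalM fX // mulr0.
have yPA : y *m P *m A = y by rewrite -mulmxA PA mulmx1.
have qlam : (q *m lam) 0 0 = 1.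
  have := frame_eq q; rewrite qA mul0mx add0r -{1}[q]scale1r => /eqP.
  by rewrite -subr_eq0 -scalerBl scaler_eq0 (negPf q_neq0) orbF subr_eq0 => /eqP <-.
rewrite /f !rmorphM rmorphB !rmorphM /= !restrict_subst // restrict_linform yPA qlam scale1r.
rewrite mevalXU -rmorphM /= mul_polyC size_scale ?mulf_neq0 //.
set c := (y *m P *m lam) 0 0; set g := G.@[_]; set h := F.@[_].
have -> : (c%:P + 'X) * g%:P - (y 0 j)%:P * h%:P = g *: 'X + (c * g - y 0 j * h)%:P.
  by rewrite -mul_polyC !(rmorphB, rmorphM) /=; ring.
rewrite size_polyDl ?size_scale ?size_polyX //.
by rewrite (leq_ltn_trans (size_polyC_leq1 _)).
Qed.

Lemma not_polar_quadric u : ~ polar_space q I u ->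
  exists kap, [/\ I kap, kap \is 2.-homog, kap.@[q 0] = 0 & (restrict_to_line u q kap)`_1 != 0].
Proof.
move=> npol; apply: NNPP => nex; apply: npol => kap Ik kh kq.
by apply: NNPP => /eqP c; apply: nex; exists kap.
Qed.

(** A quadric kap with kap(u + t q) = kap(u) + l(u) t vanishes on X, so on X the
    point x is recovered from z = x A up to the scalar l(u), where u = z P, by the
    quadratic map s(z) = l(u) u - kap(u) q.  A function F/G on X near x is then
    the pullback of (F o s)/(G o s). *)
Lemma surjective_off_Z1 y :
  proj_image A X y -> ~ fibre_length_ge q A X 2 y -> stalk_surjective A X y.
Proof.
move=> [x Xx yE] nfib; have y0 : y != 0 by rewrite yE X_proj_neq0.
have [kap [Ik kh kq polk]] : exists kap, [/\ I kap, kap \is 2.-homog, kap.@[q 0] = 0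
    & (restrict_to_line (y *m P) q kap)`_1 != 0].
  by apply: not_polar_quadric => /(fibre_ge2 y0).
have [C _ CE] := quadric_matrix kh.
pose b := C *m q^T + C^T *m q^T.
have bE u : (u *m b) 0 0 = (restrict_to_line u q kap)`_1.
  rewrite CE kq !coefD !coefZ coefX coefXn coefC /= mulr1 mulr0 addr0 add0r.
  rewrite mulmxDr !mulmxA mxE; congr (_ + _).
  have -> : u *m C^T *m q^T = (q *m C *m u^T)^T by rewrite !trmx_mul trmxK mulmxA.
  by rewrite mxE.
pose l : {mpoly k[n]} := linform (P *m b).
have lE (z : 'rV[k]_n) : l.@[z 0] = (z *m P *m b) 0 0 by rewrite linform_eval mulmxA.
pose s : n.+1.-tuple {mpoly k[n]} :=
  [tuple l * linform (col i P) - (q 0 i) *: linear_subst P kap | i < n.+1].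
have sh i : tnth s i \is 2.-homog.
  rewrite tnth_mktuple rpredB ?rpredZ ?linear_subst_homog //.
  by apply: (@dhomogM _ _ _ 1 _ 1); exact: linform_homog.
have sE z : X z -> (fun i => (tnth s i).@[(z *m A) 0]) =1 (l.@[(z *m A) 0] *: z) 0.
  move=> Xz i; set u := z *m A *m P; set t := (z *m lam) 0 0.
  have ku : kap.@[u 0] = - (restrict_to_line u q kap)`_1 * t.
    have := horner_restrict u q kap t; rewrite -frame_eq (ideal_vanishes X_closed Ihom IX Ik Xz).
    rewrite {1}(restrict_quadric q u kh) kq scale0r addr0 hornerD hornerC hornerZ hornerX.
    by move/eqP; rewrite addr_eq0 mulNr => /eqP.
  have ui : (linform (col i P)).@[(z *m A) 0] = u 0 i.
    by rewrite linform_eval colE mulmxA -colE mxE.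
  rewrite tnth_mktuple mevalB mevalM mevalZ linear_subst_eval ui lE bE -/u ku [(_ *: z) 0 i]mxE.
  have -> : z 0 i = u 0 i + t * q 0 i by rewrite {1}[z]frame_eq mxE [(_ *: q) _ _]mxE.
  by ring.
move=> U phi Uop Uy phireg.
have [|d [F [G [Fh Gh Gx phiE]]]] := phireg x; first by split=> //; rewrite -yE.
pose Ft := F \mPo s; pose Gt := G \mPo s.
have Fth : Ft \is (d * 2).-homog by apply: comp_mpoly_homog.
have Gth : Gt \is (d * 2).-homog by apply: comp_mpoly_homog.
have subE H z : H \is d.-homog -> X z ->
    (H \mPo s).@[(z *m A) 0] = l.@[(z *m A) 0] ^+ d * H.@[z 0].
  by move=> Hh Xz; rewrite comp_mpoly_meval (meval_eq _ (sE z Xz)) (meval_scale _ _ Hh).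
have [W Wh UE] := Uop.
have ly : l.@[y 0] != 0 by rewrite lE bE.
pose V (z : 'rV[k]_n) := U z /\ (l * Gt).@[z 0] != 0.
have lG (z : 'rV[k]_n) : (l * Gt).@[z 0] != 0 -> l.@[z 0] != 0 /\ Gt.@[z 0] != 0.
  by rewrite mevalM mulf_eq0 negb_or => /andP.
(* V is U with the zeros of l and of G o s removed. *)
exists V, (fun z => Ft.@[z 0] / Gt.@[z 0]); split.
- exists (fun f => exists2 w, W w & f = w * (l * Gt)) => [f [w Ww ->]|z].
    have [e wh] := Wh w Ww; exists (e + (1 + d * 2))%N.
    by apply: dhomogM => //; apply: dhomogM => //; exact: linform_homog.
  split=> [[/UE [z0 [w Ww wz]] lz]|[z0 [f [w Ww ->]]]].
    by split=> //; exists (w * (l * Gt)); [exists w | rewrite mevalM mulf_neq0].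
  rewrite mevalM mulf_eq0 negb_or => /andP [wz lz]; split=> //.
  by apply/UE; split=> //; exists w.
- split=> //; rewrite mevalM mulf_neq0 // yE subE // -yE.
  by rewrite mulf_neq0 // expf_neq0.
- by move=> z [].
- move=> z [_ [_ /lG [_ Gz]]]; exists (d * 2)%N, Ft, Gt; split=> //.
- move=> z Xz [Uz /lG [lz Gz]]; rewrite !subE //.
  move: Gz; rewrite subE // mulf_eq0 negb_or => /andP [ldz Gz].
  by rewrite -mulf_div divff // mul1r; apply: phiE.
Qed.

(** The vanishing of the discriminant makes the root a double, so that f1 is t^2
    on the line x + t q through x = u + a q; then every form vanishing on X has
    zero derivative at x in the direction q. *)
Lemma tangent_line u : (2%:R : k) != 0 -> polar_space q I u -> ~~ (u <= q)%MS ->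
  (restrict_to_line u q f1)`_1 ^+ 2 = f1.@[u 0] *+ 4 -> Tan X q.
Proof.
move=> two pol uq disc; set B := (restrict_to_line u q f1)`_1 in disc.
pose a := - B / 2%:R; pose x := a *: q + u.
have xq : ~~ (x <= q)%MS.
  apply: contra uq => xq; have -> : u = x - a *: q by rewrite addrC addKr.
  by rewrite -scaleNr addmx_sub ?scalemx_sub.
have polx : polar_space q I x by apply: polar_space_lin => //; apply: polar_space_center.
have x1 : (restrict_to_line x q f1)`_1 = 0.
  by rewrite polar_linear // polar_self // f1q -mulr_natr mul1r mulfVK // addNr.
have x0 : f1.@[x 0] = 0.
  have := horner_restrict u q f1 a; rewrite [u + _]addrC => <-.
  have four : 4%:R != 0 :> k by rewrite (natrM k 2 2) mulf_neq0.
  rewrite restrict_f1 -/B 2!hornerD hornerC hornerZ hornerX hornerXn.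
  have -> : f1.@[u 0] = B ^+ 2 / 4%:R by rewrite disc -mulr_natr mulfK.
  by rewrite /a; field; apply/andP.
exists x; first by apply: polar_quadric_in_X => //; apply: contraNneq xq => ->; rewrite sub0mx.
split=> // f fX; rewrite -coef1_restrict.
have : restrict_to_line x q f1 %| restrict_to_line x q f.
  by apply: (saturated_dvdp X_closed IX q_neq0 xq _ fX); apply: f1_dvdp.
rewrite restrict_f1 x0 x1 scale0r !add0r => /dvdpP [s ->].
by rewrite coefMXn.
Qed.

(** For x1 and x in the secant locus, the discriminant along x1 + s x is a
    polynomial of degree 2 in s, with leading coefficient the discriminant at x.
    At a root, x1 + s x can only be a multiple of q, hence x is in the span of x1
    and q.  On that line f1 has the roots x1 and x1 - B(x1) q. *)
Lemma secant_pair : (2%:R : k) != 0 -> (exists x, secant_locus q A X x) -> ~ Tan X q ->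
  exists x1 x2 : 'rV[k]_n.+1, [/\ x1 != 0, x2 != 0, ~~ same_point x1 x2
    & forall x, secant_locus q A X x <-> x != 0 /\ (same_point x x1 || same_point x x2)].
Proof.
move=> two [x1 Sx1] ntan; have [x10 pol1 fx1] := proj1 (secant_locusE x1) Sx1.
have offq x : secant_locus q A X x -> ~~ (x <= q)%MS.
  move=> [/X_proj_neq0 + _]; apply: contra => /sub_rVP [c ->].
  by rewrite -scalemxAl qA scaler0.
pose B u := (restrict_to_line u q f1)`_1.
have BN x : secant_locus q A X x -> B x != 0.
  move=> Sx; apply: contra_notN ntan => /eqP Bx; have [_ polx fx] := proj1 (secant_locusE x) Sx.
  by apply: (tangent_line two polx (offq x Sx)); rewrite -/(B x) Bx fx mul0rn expr0n.
have BL a u v : B (a *: u + v) = a * B u + B v by rewrite /B polar_linear.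
have BZ a u : B (a *: u) = a * B u.
  by rewrite -[a *: u]addr0 BL /B (restrict_center_homog q f1h) coefZ coefXn mulr0 addr0.
have f1E a c : f1.@[(a *: x1 + c *: q) 0] = c * (a * B x1 + c).
  rewrite -horner_restrict restrict_f1 2!hornerD hornerC hornerZ hornerX hornerXn.
  by rewrite (meval_scale _ _ f1h) fx1 -/(B _) BZ; ring.
have span x : secant_locus q A X x -> exists a c, x = a *: x1 + c *: q.
  move=> Sx; have [_ polx fx] := proj1 (secant_locusE x) Sx.
  have [C _ /(_ x1 x) CE] := quadric_matrix f1h; set e := (_ + _ : k) in CE.
  pose p := (B x ^+ 2) *: 'X^2 + ((B x1 * B x *+ 2 - e *+ 4) *: 'X + (B x1 ^+ 2)%:P).
  have [|s] := closed_rootP p _.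
    rewrite size_polyDl size_scale ?expf_neq0 ?BN ?size_polyXn //.
    rewrite (leq_ltn_trans (size_polyD _ _)) // gtn_max !ltnS.
    by rewrite (leq_trans (size_polyC_leq1 _)) // (leq_trans (size_scale_leq _ _)) ?size_polyX.
  rewrite /root 2!hornerD !hornerZ hornerC hornerX hornerXn => /eqP ps.
  have pols : polar_space q I (s *: x + x1) by apply: polar_space_lin.
  have disc : B (s *: x + x1) ^+ 2 = f1.@[(s *: x + x1) 0] *+ 4.
    have := horner_restrict x1 x f1 s; rewrite [x1 + _]addrC => <-.
    rewrite CE fx1 fx scale0r addr0 add0r hornerZ hornerX BL.
    apply/eqP; rewrite -subr_eq0 -ps; apply/eqP; ring.
  have sq : ((s *: x + x1)%R <= q)%MS.
    by apply: contra_notT ntan => sq; apply: (tangent_line two pols sq disc).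
  have [c E] := sub_rVP sq.
  have s0 : s != 0.
    by apply: contra (offq _ Sx1) => /eqP s0; rewrite -[x1]add0r -(scale0r x) -s0 E scalemx_sub.
  exists (- s^-1), (s^-1 * c); rewrite -scalerA -E scalerDr scalerA mulVf // scale1r scaleNr.
  by rewrite addrCA addNr addr0.
pose x2 := x1 + (- B x1) *: q.
have x2q : x2 *m A = x1 *m A by rewrite mulmxDl -scalemxAl qA scaler0 addr0.
have Sx2 : secant_locus q A X x2.
  apply/secant_locusE; split.
  - by apply: contraTneq (X_proj_neq0 (proj1 Sx1)) => x20; rewrite -x2q x20 mul0mx eqxx.
  - by rewrite /x2 addrC; apply: polar_space_lin => //; apply: polar_space_center.
  - by have := f1E 1 (- B x1); rewrite scale1r mul1r addrN mulr0.
have x20 := proj_closed_neq0 X_closed (proj1 Sx2).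
have same (x z : 'rV[k]_n.+1) : same_point x z -> exists c, x = c *: z.
  by move=> /andP [/sub_rVP].
exists x1, x2; split=> //.
  apply/negP => /same [c E]; have : x1 *m A = c *: (x1 *m A) by rewrite -{2}x2q scalemxAl -E.
  move/eqP; rewrite -subr_eq0 -{1}[x1 *m A]scale1r -scalerBl scaler_eq0.
  rewrite (negPf (X_proj_neq0 (proj1 Sx1))) orbF subr_eq0 => /eqP c1.
  move/eqP: E; rewrite -c1 scale1r -subr_eq0 opprD addNKr scaleNr opprK scaler_eq0.
  by rewrite (negPf (BN _ Sx1)) (negPf q_neq0).
have SZ c z : c != 0 -> secant_locus q A X z -> secant_locus q A X (c *: z).
  move=> c0 /secant_locusE [z0 polz fz]; apply/secant_locusE.
  by rewrite scaler_eq0 negb_or c0 (meval_scale _ _ f1h) fz mulr0; split=> //; apply: polar_spaceZ.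
move=> x; split=> [Sx|[x0 /orP [] /same [c xE]]]; last first.
- by rewrite xE; apply: SZ => //; apply: contraNneq x0 => c0; rewrite xE c0 scale0r.
- by rewrite xE; apply: SZ => //; apply: contraNneq x0 => c0; rewrite xE c0 scale0r.
have [x0 _ fx] := proj1 (secant_locusE x) Sx; split=> //.
have [a [c xE]] := span x Sx.
have a0 : a != 0.
  by apply: contra (offq _ Sx) => /eqP a0; rewrite xE a0 scale0r add0r scalemx_sub.
have scale (z : 'rV[k]_n.+1) : same_point (a *: z) z.
  by apply/eqmxP; apply: eqmx_scale.
move/eqP: fx; rewrite xE f1E mulf_eq0 => /orP [/eqP ->|].
  by rewrite scale0r addr0 scale.
rewrite addrC addr_eq0 => /eqP ->; apply/orP; right.
by rewrite -mulrN -scalerA -scalerDr scale.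
Qed.
End SecantLocus.

(** The matrix 1 - A P maps into the kernel of A, which is the line of q, so each
    of its rows is a multiple lam_i of q. *)
Lemma projection_frame (k : closedFieldType) n (q : 'rV[k]_n.+1) (A : 'M[k]_(n.+1, n)) :
  q != 0 -> \rank A = n -> q *m A = 0 ->
  [/\ pinvmx A *m A = 1%:M
    & exists lam : 'cV[k]_n.+1, A *m pinvmx A + lam *m q = 1%:M /\ q *m lam = 1%:M].
Proof.
move=> q0 rA qA; have fullA : row_full A by rewrite /row_full rA.
split; first exact: mulVpmx.
have qker : (q <= kermx A)%MS by apply/sub_kermxP.
have kerq : (kermx A <= q)%MS.
  have := mxrank_leqif_sup qker; rewrite mxrank_ker rA subSnn rank_rV q0 => -[_ <-].
  by [].
have /submxP [lam lamE] : (1%:M - A *m pinvmx A <= q)%MS.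
  apply: submx_trans kerq; apply/sub_kermxP.
  by rewrite mulmxBl mul1mx mulmxKpV ?subrr.
exists lam; have frame : A *m pinvmx A + lam *m q = 1%:M by rewrite -lamE addrC subrK.
split=> //; have : q *m (A *m pinvmx A + lam *m q) = q by rewrite frame mulmx1.
rewrite mulmxDr (mulmxA q A) (mulmxA q lam) qA mul0mx add0r [q *m lam]mx11_scalar mul_scalar_mx.
rewrite -[X in _ = X]scale1r => /eqP; rewrite -subr_eq0 -scalerBl scaler_eq0 (negPf q0) orbF.
by rewrite subr_eq0 => /eqP ->.
Qed.

Lemma quadric_off_point (k : closedFieldType) m (I : {mpoly k[m]} -> Prop)
    (X : 'rV[k]_m -> Prop) (q : 'rV[k]_m) :
  proj_closed X -> homogeneous_ideal I -> generates_ideal_sheaf I X ->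
  generated_by_quadrics I -> q != 0 -> ~ X q ->
  exists f1, [/\ I f1, f1 \is 2.-homog & f1.@[q 0] = 1].
Proof.
move=> Xcl [[_ _ IM] _] IX Igen q0 qX; apply: NNPP => nex; apply: qX.
apply: (ideal_zero_locus Xcl IX q0) => f /Igen [r [a [g [gP ->]]]].
rewrite raddf_sum big1 // => i _; have [gh Ig] := gP i; rewrite /= mevalM.
have [->|gq] := eqVneq (g i).@[q 0] 0; first by rewrite mulr0.
case: nex; exists ((g i).@[q 0]^-1 *: g i); split.
- by rewrite -mul_mpolyC; apply: IM.
- exact: rpredZ.
- by rewrite mevalZ mulVf.
Qed.

(** * The theorem *)

Theorem lemma3p8 (k : closedFieldType) (char0 : [pchar k] =i pred0)
  (n p : nat) (X : 'rV[k]_n.+1 -> Prop)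
  (X_closed : proj_closed X) (X_nondeg : nondegenerate_variety X)
  (p_ge2 : (2 <= p)%N) (X_N2p : N2p_scheme_theoretically p X)
  (q : 'rV[k]_n.+1) (q_neq0 : q != 0) (q_notin_X : ~ X q)
  (A : 'M[k]_(n.+1, n)) (A_rank : \rank A = n) (A_q : q *m A = 0)
  (Sigma_neq0 : exists x, secant_locus q A X x) :
  [/\ (exists L : 'M[k]_n.+1,
         quadric_hypersurface_in L (secant_locus q A X) /\ (q <= L)%MS),
      [/\ (forall y, proj_image A (secant_locus q A X) y <-> Z_1 q A X y),
          is_linear_space (Z_1 q A X)
        & (forall y, Z_1 q A X y <-> coker_support A X y)]
    & (Sec X q -> ~ Tan X q ->
       exists x1 x2 : 'rV[k]_n.+1,
         [/\ x1 != 0, x2 != 0, ~~ same_point x1 x2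
           & forall x, secant_locus q A X x <->
               x != 0 /\ (same_point x x1 || same_point x x2)])].
Proof.
have [PA [lam [frame qlam]]] := projection_frame q_neq0 A_rank A_q.
have [I [Ihom IX Igen [F tor]]] := X_N2p.
have [f1 [If1 f1h f1q]] := quadric_off_point X_closed Ihom IX Igen q_neq0 q_notin_X.
have linear_syzygies kap j : (3 <= j)%N -> I kap -> kap \is j.-homog ->
    in_span (fun l => linform (col l A)) I (linform lam * kap) ->
    in_span (fun l => linform (col l A)) I kap.
  move=> j3; apply: (span_of_lam_mul_span frame A_q qlam (F := F) Ihom) => [f|].
    exact: generated_const0.
  by apply: tor; rewrite ?p_ge2 // neq_ltn [X in _ || X]ltnS j3 orbT.
have f1_dvdp u : polar_space q I u ->
    forall f, I f -> restrict_to_line u q f1 %| restrict_to_line u q f.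
  by move=> pol; apply: (dvdp_restrict frame A_q qlam Ihom Igen linear_syzygies If1 f1h f1q pol).
have locusE := secant_locusE frame PA A_q X_closed q_neq0 q_notin_X Ihom IX If1 f1h f1q f1_dvdp.
have inZ1 := Z1E frame PA A_q X_closed q_neq0 q_notin_X Ihom IX f1h f1q f1_dvdp.
split; last 1 first.
- move=> _; apply: (secant_pair frame PA A_q X_closed q_neq0 q_notin_X Ihom IX If1 f1h f1q
    f1_dvdp) => //.
  by rewrite (proj1 (pcharf0P k) char0).
- have [||L LE] := @linear_subspace_mx _ _ (polar_space q I).
  + exact: polar_space0.
  + by move=> a u v; apply: polar_space_lin.
  + have qL : (q <= L)%MS by apply/LE; exact: polar_space_center.
    exists L; split=> //; exists f1; split=> // [|x]; first by exists q; rewrite ?f1q ?oner_eq0.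
    by split=> [/locusE [? /LE ? ?]|[? /LE ? ?]]; last apply/locusE; split.
split=> [y||y].
- by split=> [[x [Xx fib] ->]|[[x Xx ->] fib]]; [split=> //; exists x | exists x].
- have [||M ME] := @linear_subspace_mx _ _ (fun y => polar_space q I (y *m pinvmx A)).
  + by rewrite mul0mx; apply: polar_space0.
  + by move=> a u v hu hv; rewrite mulmxDl -scalemxAl; apply: polar_space_lin.
  + by exists M => y; split=> [/inZ1 [? /ME]|[? /ME ?]] //; apply/inZ1.
split=> [Zy|[Yy nsurj]].
  split; first by case: Zy.
  exact: (Z1_not_surjective frame PA A_q X_closed q_neq0 q_notin_X Zy).
split=> //; apply: NNPP => nfib; apply: nsurj.
exact: (surjective_off_Z1 frame PA A_q X_closed q_neq0 q_notin_X Ihom IX f1h f1q f1_dvdp Yy nfib).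
Qed.
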